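(* Let $W$ be a finitely generated Coxeter group with Coxeter generating set $S$, and let $\alpha\in\mathrm{Aut}(W)$. Then $\alpha$ is inner-by-graph if and only if it satisfies the following two conditions: (1) $\alpha$ maps every parabolic subgroup to a parabolic subgroup. (2) For all $s,t\in S$ such that $st$ has finite order in $W$, there is a pair $s',t'\in S$ such that $\alpha(st)$ is conjugate to $s't'$.
   Context: A Coxeter generating set of $W$ is a set $S\subseteq W$ such that $(W,S)$ is a Coxeter system (i.e. $W$ has a Coxeter presentation on $S$). A parabolic subgroup of $W$ (with respect to $S$) is a subgroup conjugate in $W$ to $W_J=\langle J\rangle$ for some $J\subseteq S$. An automorphism $\alpha$ of $W$ is inner-by-graph (with respect to $S$) if $\alpha(S)=wSw^{-1}$ (as sets) for some $w\in W$; equivalently, $\alpha$ is a composition of an inner automorphism with a graph automorphism, i.e. an automorphism stabilising $S$ setwise. *)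

(* Defs.v *)
From HB Require Import structures.
From mathcomp Require Import all_boot.
From mathcomp Require Import boolp classical_sets.

Set Implicit Arguments.
Unset Strict Implicit.
Unset Printing Implicit Defensive.

Local Open Scope classical_set_scope.
Local Open Scope group_scope.

(* Group words over an alphabet X: the letter (x, false) stands for x and
   (x, true) for the formal inverse of x. *)
Definition word (X : Type) := seq (X * bool).

(* The congruence whose quotient is the group < X | R >: free reduction
   together with insertion and deletion of relators. *)
Inductive word_eq (X : Type) (R : set (word X)) : word X -> word X -> Prop :=
| word_eq_refl u : word_eq R u u
| word_eq_sym u v : word_eq R u v -> word_eq R v u
| word_eq_trans u v w : word_eq R u v -> word_eq R v w -> word_eq R u w
| word_eq_cancel u v x b :
    word_eq R (u ++ [:: (x, b); (x, ~~ b)] ++ v) (u ++ v)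
| word_eq_relator u v r : R r -> word_eq R (u ++ r ++ v) (u ++ v).

Definition word_eval (W : groupType) (X : Type) (f : X -> W) (w : word X) : W :=
  \prod_(a <- w) (if a.2 then (f a.1)^-1 else f a.1).

(* The map f : X -> W induces an isomorphism from < X | R > onto W. *)
Definition presents (W : groupType) (X : Type) (f : X -> W)
    (R : set (word X)) : Prop :=
  (forall g : W, exists w, word_eval f w = g) /\
  (forall u v, word_eval f u = word_eval f v <-> word_eq R u v).

(* The value 0 encodes an infinite entry of the matrix. *)
Definition coxeter_matrix (X : Type) (m : X -> X -> nat) : Prop :=
  [/\ forall s, m s s = 1%N,
      forall s t, m s t = m t s
    & forall s t, s <> t -> m s t <> 1%N].

(* The relators (s t)^(m s t); an infinite entry contributes only the empty
   word, that is, no relation. *)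
Definition coxeter_relators (X : Type) (m : X -> X -> nat) : set (word X) :=
  [set r | exists s t, r = flatten (nseq (m s t) [:: (s, false); (t, false)])].

Definition coxeter_generating_set (W : groupType) (S : set W) : Prop :=
  exists m : S -> S -> nat,
    coxeter_matrix m /\ presents (fun s : S => val s) (coxeter_relators m).

Definition generated (W : groupType) (J : set W) : set W :=
  smallest (fun H : set W => group_closed [in H]) J.

Definition finitely_generated (W : groupType) : Prop :=
  exists g : seq W, generated [set` g] = [set: W].

Definition conjugate (W : groupType) (x y : W) : Prop :=
  exists w, y = w * x * w^-1.

Definition parabolic (W : groupType) (S P : set W) : Prop :=
  exists (J : set W) (w : W),
    J `<=` S /\ P = [set w * x * w^-1 | x in generated J].

Definition inner_by_graph (W : groupType) (S : set W) (alpha : W -> W) : Prop :=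
  exists w : W, alpha @` S = [set w * s * w^-1 | s in S].

Definition finite_order (W : groupType) (x : W) : Prop :=
  exists2 n : nat, (0 < n)%N & x ^+ n = 1.

(* Main.v *)
Require Import Defs.
From HB Require Import structures.
From mathcomp Require Import all_boot.
From mathcomp Require Import boolp classical_sets cardinality.

Set Implicit Arguments.
Unset Strict Implicit.
Unset Printing Implicit Defensive.

Local Open Scope classical_set_scope.
Local Open Scope group_scope.

(** Let [R = alpha(S)].  The direct implication is formal; for the converse one
    must find a chamber of the Cayley graph of [S] whose walls are those of [R].
    Everything is read off a single function [sep], which says whether the wall of
    a reflection separates two chambers, and which exists by
    [cocycle_of_presentation] because each relator crosses every wall an even
    number of times.

    By (1), elements of [R] are [S]-reflections [image_reflection].  By (1) for an
    infinite dihedral pair and by (2) for the other pairs, any two elements of [R]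
    are walls of a common [S]-chamber [exists_walls]; this rests on
    [coset_refl_unique]: a nontrivial coset of a standard parabolic subgroup
    contains at most one reflection.  What has to be found is, for each [r] in
    [R], one of the two [S]-half-spaces bounded by its wall, such that any two of
    the chosen half-spaces meet in a fundamental domain of the dihedral group they
    define.  Locally the choice is determined up to exchanging both sides, and
    the difficulty is a consistent global choice around the cycles of the diagram.

    If [r] has infinitely many conjugates, then its [S]-half-space is obtained from
    the [R]-half-space of [r] containing the identity: far from the wall the two
    partitions coincide [matching].  Indeed the part of an [R]-half-space far from
    its wall is connected in a generalized sense: galleries that leave the wall
    are confluent [confluence_up], as two diverging branches can be joined around
    the rank two residue that they span.  Where the residue is infinite, it cannot
    be closed up, but it is at bounded distance from an [S]-residue by (1), hence
    on one [S]-side.  So the [S]-side, which changes only near the wall, is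
    constant.  The matched half-spaces of two generators are compatible
    [geometric_matched]: for a finite dihedral group, test them on a chamber far
    from all its walls [deep_chamber].

    The generators with finitely many conjugates span finite direct factors
    [finite_class_factor].  Their diagram is a forest, because a walk without
    backtracking produces arbitrarily long elements [walk_desc], so that for them
    there are no cycles and signs can be chosen leaf by leaf [forest_signs].

    Finally, only finitely many walls are mismatched at the identity, and crossing
    the wall of some [r] in [R] which is mismatched removes one of them
    [mismatch_decrease].  So some chamber [c] lies in all the chosen half-spaces.
    By the argument of Tits [domain_translates] the translates of their
    intersection are separated by the walls of [R] as [R]-lengths prescribe, which
    forces the walls of [c] to be those of [R] [conjugate_systems]. *)

(** * Conjugation, finite sets and generated subgroups *)

(** Normalizes to reduced left-associated words of the free group. *)
Ltac gsimp := rewrite ?conjgE;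
  rewrite ?(mulgA, invgM, invgK, mulgK, mulgVK, mulVg, mulgV, mul1g, mulg1, invg1).

Lemma invol_inv (W : groupType) (s : W) : s * s = 1 -> s^-1 = s.
Proof. by move=> ss; apply: mulg1_eq. Qed.

Lemma conjg_eqV (W : groupType) (x y z : W) : (x ^ y == z) = (x == z ^ y^-1).
Proof. by apply/eqP/eqP => [<-|->]; rewrite ?conjgK ?conjgKV. Qed.

Lemma conjg_conj (W : groupType) (x y z : W) : x ^ (y ^ z) = ((x ^ z^-1) ^ y) ^ z.
Proof. by rewrite [y ^ z]conjgE !conjgM. Qed.

Lemma conjg_comm (W : groupType) (y z : W) : z ^ y = z -> y * z = z * y.
Proof. by rewrite conjgE => e; rewrite -{1}e mulVKg. Qed.

Lemma conjg_comm_sym (W : groupType) (y z : W) : z ^ y = z -> y ^ z = y.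
Proof. by move=> /conjg_comm e; rewrite conjgE e mulKg. Qed.

Lemma conjgVM (W : groupType) (x y : W) : x ^ y^-1 * y = y * x.
Proof. by rewrite conjgE invgK -!mulgA mulVg mulg1. Qed.

Lemma finite_bound (T : choiceType) (F : set T) (f : T -> nat) :
  finite_set F -> exists K, forall x, F x -> f x < K.
Proof.
move=> /finite_seqP[L ->]; exists (\max_(x <- L) f x).+1 => x /= xL.
by rewrite ltnS; apply: leq_bigmax_seq.
Qed.

Lemma finite_sub_seq (T : choiceType) (F : set T) (L : seq T) :
  (forall x, F x -> x \in L) -> finite_set F.
Proof. by move=> FL; apply: sub_finite_set (finite_seq L). Qed.

Lemma inj_not_finite (T : choiceType) (F : set T) (f : nat -> T) :
  injective f -> (forall n, F (f n)) -> ~ finite_set F.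
Proof.
move=> finj Ff /finite_seqP[L FL].
have := @uniq_leq_size _ (map f (iota 0 (size L).+1)) L.
rewrite map_inj_uniq // iota_uniq size_map size_iota ltnn => /(_ isT) h.
by apply/notF/h => _ /mapP[n _ ->]; have := Ff n; rewrite FL.
Qed.

Lemma finite_inj (U : choiceType) (T : finType) (F : set U) (f : U -> T) :
  (forall x y, F x -> F y -> f x = f y -> x = y) -> finite_set F.
Proof.
move=> finj; have [[x0 Fx0]|F0] := pselect (exists x, F x); last first.
  by apply: (@finite_sub_seq _ _ [::]) => x Fx; case: F0; exists x.
pose g (v : T) := xget x0 [set w | F w /\ f w = v].
apply: (@sub_finite_set _ _ (g @` [set: T])); last exact/finite_image/finite_finset.
move=> x Fx; exists (f x) => //; rewrite /g.
case: xgetP => [y _ [Fy /finj]|/(_ x)[]//]; exact.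
Qed.

Section Words.
Variable W : groupType.
Implicit Types (I J : set W) (w x y t : W).

(** Words are kept only through their length and their value. *)
Inductive wordn I : nat -> W -> Prop :=
| wordn0 : wordn I 0 1
| wordnS n w s : wordn I n w -> I s -> wordn I n.+1 (w * s).

Definition span I w := exists n, wordn I n w.

Definition invols I := forall s, I s -> s * s = 1.

Lemma span1 I : span I 1.
Proof. by exists 0; constructor. Qed.

Lemma spanMr I w s : span I w -> I s -> span I (w * s).
Proof. by move=> [n wn] Is; exists n.+1; constructor. Qed.

Lemma span_gen I s : I s -> span I s.
Proof. by move=> Is; rewrite -[s]mul1g; apply: spanMr => //; apply: span1. Qed.

Lemma span_ind I (P : W -> Prop) :
  P 1 -> (forall w s, span I w -> P w -> I s -> P (w * s)) ->
  forall w, span I w -> P w.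
Proof.
move=> P1 PM w [n]; elim => {n w} // n w s wn Pw Is.
by apply: PM => //; exists n.
Qed.

Lemma spanM I x y : span I x -> span I y -> span I (x * y).
Proof.
move=> Ix; elim/span_ind; first by rewrite mulg1.
by move=> w s _ Iw Is; rewrite mulgA; apply: spanMr.
Qed.

Lemma spanV I w : invols I -> span I w -> span I w^-1.
Proof.
move=> iI; elim/span_ind; first by rewrite invg1; apply: span1.
move=> {}w s _ Iw Is; rewrite invgM (invol_inv (iI _ Is)).
by apply: spanM => //; apply: span_gen.
Qed.

Lemma spanJ I x y : invols I -> span I x -> span I y -> span I (x ^ y).
Proof. by move=> iI Ix Iy; apply: spanM; [apply: spanV|apply: spanM]. Qed.

Lemma sub_span I J w : I `<=` J -> span I w -> span J w.
Proof.
move=> IJ; elim/span_ind => [|{}w s _ Jw Is]; first exact: span1.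
by apply: spanMr => //; apply: IJ.
Qed.

Lemma wordn_cons I n w :
  wordn I n.+1 w -> exists a v, [/\ I a, wordn I n v & w = a * v].
Proof.
elim: n w => [|n IHn] w wn; inversion wn as [|m v s vm Is e1 e2]; subst.
  inversion vm; subst; exists s, 1; split => //.
  by rewrite mul1g mulg1.
have [a [u [Ia un ->]]] := IHn _ vm.
exists a, (u * s); split => //; last by rewrite mulgA.
by constructor.
Qed.

Lemma wordn_consS I n a v : wordn I n v -> I a -> wordn I n.+1 (a * v).
Proof.
move=> + Ia; elim=> [|{}n {}v s _ avn Is].
  rewrite mulg1 -[a]mul1g; constructor => //; exact: wordn0.
by rewrite mulgA; constructor.
Qed.

Lemma span_indl I (P : W -> Prop) :
  P 1 -> (forall s w, I s -> span I w -> P w -> P (s * w)) ->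
  forall w, span I w -> P w.
Proof.
move=> P1 PM w [n]; elim: n w => [|n IHn] w wn.
  by inversion wn.
have [a [v [Ia vn ->]]] := wordn_cons wn.
by apply: PM => //; [exists n|apply: IHn].
Qed.

Lemma wordnV I n w : invols I -> wordn I n w -> wordn I n w^-1.
Proof.
move=> iI; elim=> [|{}n {}w s _ wn Is]; first by rewrite invg1; constructor.
by rewrite invgM (invol_inv (iI _ Is)); apply: wordn_consS.
Qed.

End Words.

(** * Dihedral groups *)

Section Alternating.
Variable W : groupType.
Implicit Types a b w x : W.

Fixpoint alt a b n : W := if n is m.+1 then a * alt b a m else 1.
(** The letter that prolongs [alt a b n]. *)
Definition nxt a b n : W := if odd n then b else a.

Lemma altS a b n : alt a b n.+1 = alt a b n * nxt a b n.
Proof.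
elim: n a b => [|n IHn] a b; first by rewrite /nxt /= mul1g mulg1.
rewrite [alt a b n.+2]/= -/(alt b a n.+1) IHn mulgA; congr (_ * _).
by rewrite /nxt /=; case: (odd n).
Qed.

Lemma expg_swap a b n : (a * b) ^+ n * a = a * (b * a) ^+ n.
Proof.
elim: n => [|n IHn]; first by rewrite mul1g mulg1.
by rewrite expgS -mulgA IHn expgS !mulgA.
Qed.

Lemma alt_expg a b n : a * a = 1 -> b * b = 1 ->
  alt a b n = (a * b) ^+ n * alt b a n.
Proof.
elim: n a b => [|n IHn] a b aa bb; first by rewrite mulg1.
rewrite [LHS]/= IHn // mulgA -expg_swap -mulgA expgSr -!mulgA.
by congr (_ * (_ * _)); rewrite [alt b a n.+1]/= mulgA bb mul1g.
Qed.

(** The letter added last to an alternating word crosses the wall of the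
    palindrome [(a * b) ^+ n * a]. *)
Lemma alt_wall a b n : a * a = 1 -> b * b = 1 ->
  alt a b n.+1 = (a * b) ^+ n * a * alt a b n.
Proof.
by move=> aa bb; rewrite [LHS]/= alt_expg // mulgA -expg_swap.
Qed.

Lemma expg_inv a b n : a * a = 1 -> b * b = 1 -> (b * a) ^+ n = (a * b) ^- n.
Proof. by move=> aa bb; rewrite -expVgn invgM !invol_inv. Qed.

End Alternating.

Section Dihedral.
Variable W : groupType.
Implicit Types a b p q x : W.

Lemma pair_span_alt a b w : a * a = 1 -> b * b = 1 -> span [set a; b] w ->
  exists n, w = alt a b n \/ w = alt b a n.
Proof.
move=> aa bb.
elim/span_indl => [|c {}w [->|->] _ [[|n] [->|->]]]; first by exists 0; left.
- by exists 1%N; left.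
- by exists 1%N; left.
- by exists n; right; rewrite /= mulgA aa mul1g.
- by exists n.+2; left.
- by exists 1%N; right.
- by exists 1%N; right.
- by exists n.+2; right.
- by exists n; left; rewrite /= mulgA bb mul1g.
Qed.

Lemma altE a b n : alt a b n = (a * b) ^+ n./2 * (if odd n then a else 1).
Proof.
elim: n => [|n IHn]; first by rewrite mulg1.
rewrite altS {}IHn /nxt -uphalfE uphalf_half /=; case: (odd n) => /=.
  by rewrite add1n expgSr -mulgA mulg1.
by rewrite add0n mulg1.
Qed.

Definition rotation (u x : W) := exists k, x = u ^+ k \/ x = u ^- k.

Variables p q : W.
Hypotheses (pp : p * p = 1) (qq : q * q = 1).
Let u := p * q.
Let pV := invol_inv pp.
Let qV := invol_inv qq.

Lemma span_rotation x : span [set p; q] x ->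
  rotation u x \/ rotation u (x * p).
Proof.
have uV : u^-1 = q * p by rewrite /u invgM pV qV.
move=> /(pair_span_alt pp qq) [n [->|->]]; rewrite altE; case: (odd n).
- by right; exists n./2; left; rewrite -mulgA pp mulg1.
- by left; exists n./2; left; rewrite mulg1.
- by right; exists n./2.+1; right; rewrite -mulgA -expgSr -expVgn uV.
- by left; exists n./2; right; rewrite mulg1 -expVgn uV.
Qed.

Lemma rotation_inv x : rotation u x -> x ^ p = x^-1 /\ x ^ q = x^-1.
Proof.
have up : u ^ p = u^-1 by rewrite /u conjgE pV !mulgA pp mul1g invgM pV qV.
have uq : u ^ q = u^-1 by rewrite /u conjgE qV -!mulgA qq mulg1 invgM pV qV.
move=> [k [->|->]]; rewrite ?conjVg !conjXg up uq expVgn ?invgK //.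
Qed.

Lemma flip_invol x : rotation u (x * p) -> x * x = 1 /\ u ^ x = u^-1.
Proof.
move=> rx; have [e _] := rotation_inv rx; set y := x * p in rx e.
have -> : x = y * p by rewrite /y -mulgA pp mulg1.
split; first by rewrite -mulgA -{1}pV -conjgE e mulgV.
rewrite conjgM; have -> : u ^ y = u.
  by rewrite conjgE; case: rx => k [->|->]; rewrite ?invgK;
     [rewrite (commuteX k (commute_refl u)) mulKg|
      rewrite mulgA -(commuteX k (commute_refl u)) mulgK].
have [] // := @rotation_inv u; by exists 1%N; left.
Qed.

End Dihedral.

(** * Coxeter systems through their walls *)

(** A Coxeter system, seen through its walls: [sep w t] says that the wall of
    the reflection [t] separates the chamber [1] from the chamber [w].  The
    chamber [x * s] is adjacent to [x] across the wall of [x * s * x^-1], the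
    [t] with [t ^ x = s], and this is all that the last axiom says.  Existence
    of such a [sep] is the only consequence of the presentation used below:
    it yields the exchange condition. *)
Record reflection_cocycle (W : groupType) (S : set W) (sep : W -> W -> bool) :
    Prop := ReflectionCocycle {
  gen_invol : invols S;
  gen_span : forall w, span S w;
  sep1 : forall t, sep 1 t = false;
  sepMs : forall x s t, S s -> sep (x * s) t = sep x t (+) (t ^ x == s)
}.

Definition refl (W : groupType) (S : set W) (t : W) :=
  exists s x, S s /\ t = s ^ x.

Section CoxeterSystem.
Variables (W : groupType) (S : set W) (sep : W -> W -> bool).
Hypothesis H : reflection_cocycle S sep.
Implicit Types (I J : set W) (a b s t w x y z p q r : W).
Let gsep1 := sep1 H.
Local Notation refl := (refl S).

Lemma involS I : I `<=` S -> invols I.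
Proof. by move=> IS s /IS /(gen_invol H). Qed.

Lemma sep_gen s t : S s -> sep s t = (t == s).
Proof. by move=> Ss; rewrite -[s in LHS]mul1g (sepMs H) // gsep1 conjg1. Qed.

(** The cocycle identity: cross from [1] to [x], then from [x] to [x * y]; the
    second part is the gallery from [1] to [y] moved by [x]. *)
Lemma sepM x y t : sep (x * y) t = sep x t (+) sep y (t ^ x).
Proof.
elim/span_ind: y / (gen_span H y) => [|y s _ IHy Ss].
  by rewrite mulg1 gsep1 addbF.
by rewrite [sep (y * s) _](sepMs H) // mulgA (sepMs H) // IHy -conjgM addbA.
Qed.

Lemma sepV x t : sep x^-1 t = sep x (t ^ x^-1).
Proof. by have := sepM x^-1 x t; rewrite mulVg gsep1; case: (sep _ _); case: (sep _ _). Qed.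

Lemma refl_gen s : S s -> refl s.
Proof. by move=> Ss; exists s, 1; rewrite conjg1. Qed.

Lemma reflJ t x : refl t -> refl (t ^ x).
Proof. by move=> [s [y [Ss ->]]]; exists s, (y * x); rewrite conjgM. Qed.

Lemma refl_invol t : refl t -> t * t = 1.
Proof. by move=> [s [x [/(gen_invol H) ss ->]]]; rewrite -conjMg ss conj1g. Qed.

Lemma reflV t : refl t -> t^-1 = t.
Proof. by move/refl_invol/invol_inv. Qed.

Lemma sep_conj u q x : S q -> 
  sep (u * q * u^-1) x = sep u x (+) (x ^ u == q) (+) sep u (x ^ (u * q * u^-1)).
Proof. by move=> Sq; rewrite sepM (sepMs H) // sepV -conjgM. Qed.

Lemma sep_refl t : refl t -> sep t t.
Proof.
move=> [s [x [Ss ->]]]; rewrite conjgE mulgA -[X in _ * X]invgK.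
rewrite sep_conj //; set t0 := _ * _ * _.
have -> : t0 ^ x^-1 = s by rewrite /t0; gsimp.
by rewrite conjgE mulKg eqxx; case: (sep _ _).
Qed.

Lemma refl_neq1 t : refl t -> t != 1.
Proof. by move=> /sep_refl; apply: contraL => /eqP ->; rewrite gsep1. Qed.

Lemma sep_mul_refl t x : refl t -> sep (t * x) t = ~~ sep x t.
Proof. by move=> rt; rewrite sepM sep_refl //= conjgE mulKg. Qed.

(** The strong exchange condition: a wall separating [1] from [w] is crossed by
    any word for [w], and folding the word at such a crossing deletes a letter. *)
Lemma wordn_del I n w t : I `<=` S -> wordn I n w -> sep w t ->
  wordn I n.-1 (t * w).
Proof.
move=> IS wn; elim: {n w} wn => [|n w s wn IHw Is]; first by rewrite gsep1.
rewrite (sepMs H) //; last exact: IS.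
case: (boolP (sep w t)) => [swt _ | _ /= /eqP e] /=.
  case: n wn IHw => [|n] wn IHw.
    by inversion wn; subst; rewrite gsep1 in swt.
  by rewrite mulgA; constructor => //; apply: IHw.
suff -> : t * (w * s) = w by [].
have -> : t = s ^ w^-1 by rewrite -e conjgK.
by gsimp; rewrite -mulgA (gen_invol H (IS _ Is)) mulg1.
Qed.

(** A wall fixed by the reflection [r] and different from that of [r] crosses it
    at a right angle, so that [1] and [r] are on the same side of it. *)
Lemma sep_commute r x : refl r -> refl x -> r * x = x * r -> sep r x -> r = x.
Proof.
move=> [q [v [Sq rE]]] rx com.
have [u {}rE] : exists u, r = u * q * u^-1 by exists v^-1; rewrite rE; gsimp.
have xE : x ^ r = x by rewrite conjgE -com mulKg.
rewrite {1}rE sep_conj // -rE xE.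
case: (sep u x); rewrite ?addbF //= ?addbT ?negbK.
all: by rewrite conjg_eqV => /eqP ->; rewrite conjgE invgK mulgA.
Qed.

Lemma lenP w : exists n, `[< wordn S n w >].
Proof. by have [n wn] := gen_span H w; exists n; apply/asboolP. Qed.

Definition len w := ex_minn (lenP w).

Lemma len_wordn w : wordn S (len w) w.
Proof. by rewrite /len; case: ex_minnP => n /asboolP. Qed.

Lemma len_le n w : wordn S n w -> len w <= n.
Proof. by move=> wn; rewrite /len; case: ex_minnP => m _; apply; apply/asboolP. Qed.

Lemma len1 : len 1 = 0.
Proof. by apply/eqP; rewrite -leqn0; apply/len_le/wordn0. Qed.

Lemma len_eq0 w : len w = 0 -> w = 1.
Proof. by move=> w0; have := len_wordn w; rewrite w0 => wn; inversion wn. Qed.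

Lemma lenV w : len w^-1 = len w.
Proof.
suff le x : len x^-1 <= len x by apply/eqP; rewrite eqn_leq le -{1}[w]invgK le.
by apply/len_le/wordnV; [apply: involS|apply: len_wordn].
Qed.

Lemma sep_len t w : sep w t -> len (t * w) < len w.
Proof.
move=> st; have w0 : len w != 0.
  by apply: contraL st => /eqP/len_eq0 ->; rewrite gsep1.
by rewrite -[ltnRHS]prednK ?lt0n // ltnS; apply/len_le/wordn_del/st/len_wordn.
Qed.

Lemma nsep_len t w : refl t -> ~~ sep w t -> len w < len (t * w).
Proof.
move=> rt nst; have := @sep_len t (t * w).
by rewrite sep_mul_refl // mulgA refl_invol // mul1g; apply.
Qed.

Lemma lenMs_le s w : S s -> len (s * w) <= (len w).+1.
Proof. by move=> Ss; apply/len_le/wordn_consS/Ss/len_wordn. Qed.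

Lemma len_up s w : S s -> ~~ sep w s -> len (s * w) = (len w).+1.
Proof.
move=> Ss nsw; apply/eqP; rewrite eqn_leq lenMs_le //.
exact/nsep_len/nsw/refl_gen.
Qed.

Lemma len_down s w : S s -> sep w s -> len w = (len (s * w)).+1.
Proof.
move=> Ss sw; rewrite -(len_up Ss); first by rewrite mulgA (gen_invol H Ss) mul1g.
by rewrite sep_mul_refl ?sw //; apply: refl_gen.
Qed.

(** Conjugating a reflection [r] by a generator [x] moves the chamber to the
    adjacent one, and the length of [r] measures the distance of the chamber to
    the wall: it drops by two, stays, or grows by two. *)
Section Trichotomy.
Variables (r x : W).
Hypotheses (rr : refl r) (Sx : S x) (rx : r <> x).

Let lenJ : len (r ^ x) = len (x * (r * x)).
Proof. by rewrite conjgE (invol_inv (gen_invol H Sx)). Qed.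

Let lenR : len (r * x) = len (x * r).
Proof. by rewrite -lenV invgM (reflV rr) (invol_inv (gen_invol H Sx)). Qed.

Let sepR : sep (r * x) x = sep r x (+) (x ^ r == x).
Proof. exact: (sepMs H). Qed.

Lemma sep_len_conj : sep r x -> len (r ^ x) < len r.
Proof.
move=> srx; rewrite lenJ.
have -> : len r = (len (r * x)).+1 by rewrite lenR; apply: len_down.
rewrite (@len_down x (r * x)) ?ltnS ?leqnSn // sepR srx.
apply/eqP => /conjg_comm com; apply: rx.
exact: (sep_commute rr (refl_gen Sx) com srx).
Qed.

Lemma nsep_len_conj : ~~ sep r x -> r ^ x <> r -> len (r ^ x) = (len r).+2.
Proof.
move=> nsrx nrx; rewrite lenJ len_up //; first by rewrite lenR len_up.
rewrite sepR (negPf nsrx) /=; apply/eqP => /conjg_comm_sym; exact: nrx.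
Qed.

Lemma nsep_len_conj_le : ~~ sep r x -> len r <= len (r ^ x).
Proof.
move=> nsrx; have [-> //|/eqP nrx] := eqVneq (r ^ x) r.
by rewrite nsep_len_conj // -addn2 leq_addr.
Qed.

End Trichotomy.

(** * Standard parabolic subgroups *)

Section Parabolic.
Variable I : set W.
Hypothesis IS : I `<=` S.
Let iI : invols I := involS IS.

Lemma sep_span w t : span I w -> sep w t -> span I t.
Proof.
elim/span_ind: w / => [|w s Iw IHw Is]; first by rewrite gsep1.
rewrite (sepMs H) //; last exact: IS.
case: (sep w t) IHw => [It _|_ /=]; first exact: It.
rewrite conjg_eqV => /eqP ->; apply: spanJ => //; last exact: spanV.
exact: span_gen.
Qed.

Lemma nsep_span w t : span I w -> ~ span I t -> sep w t = false.
Proof. by move=> Iw nIt; apply/negP => /(sep_span Iw). Qed.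

Lemma has_ldesc w : span I w -> w <> 1 -> exists2 a, I a & sep w a.
Proof.
move=> [n]; elim/ltn_ind: n w => n IHn w wn w1.
case: n wn IHn => [|n] wn IHn; first by inversion wn; subst.
have [a [v [Ia vn wE]]] := wordn_cons wn.
have aa := iI Ia; have ra := refl_gen (IS Ia).
case: (boolP (sep v a)) => [sva|nsva]; last first.
  by exists a => //; rewrite wE sep_mul_refl.
have := wordn_del IS vn sva; rewrite -wE => wn'.
by apply: IHn wn' w1; case: n {vn wn}.
Qed.

(** Every residue has a chamber on the base side of all its walls: take one of
    minimal length in the coset. *)
Lemma coset_min x : exists2 g, span I g & forall y, span I y -> ~~ sep (g * x) y.
Proof.
have [n] := ubnP (len x); elim: n x => // n IHn x; rewrite ltnS => xn.
have [[y [Iy sxy]]|none] := pselect (exists y, span I y /\ sep x y).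
  have [|g Ig gP] := IHn (y * x); first exact: leq_trans (sep_len sxy) xn.
  exists (g * y); first exact: spanM.
  by move=> z Iz; rewrite -mulgA; apply: gP.
exists 1; first exact: span1.
by move=> y Iy; rewrite mul1g; apply/negP => sxy; apply: none; exists y.
Qed.

(** It suffices to test the base side on the simple walls of the residue: the
    correction [g] of [coset_min] would have a left descent, and that descent
    would separate [1] from [x]. *)
Lemma nsep_coset x : (forall a, I a -> ~~ sep x a) ->
  forall y, span I y -> ~~ sep x y.
Proof.
move=> nx; have [g Ig gP] := coset_min x.
suff -> : x = g * x by [].
suff g1 : g^-1 = 1 by rewrite -[g]invgK g1 invg1 mul1g.
have IgV : span I g^-1 by apply: spanV.
apply: contrapT => /(has_ldesc IgV) [a Ia sga].
have := nx a Ia; rewrite -[x](mulKg g) sepM sga /= negbK.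
apply/negP/gP/spanJ => //; exact: span_gen.
Qed.

Lemma gen_in_span s : S s -> span I s -> I s.
Proof.
move=> Ss Is; have s1 : s <> 1 by apply/eqP/refl_neq1/refl_gen.
by have [a Ia] := has_ldesc Is s1; rewrite sep_gen // => /eqP <-.
Qed.

(** A reflection in [span I] which is not simple has a descent in [I], and
    conjugating by it shortens the reflection. *)
Lemma refl_in_span p : refl p -> span I p ->
  exists a g, [/\ I a, span I g & p = a ^ g].
Proof.
have [n] := ubnP (len p); elim: n p => // n IHn p; rewrite ltnS => pn rp Ip.
have p1 : p <> 1 by apply/eqP/refl_neq1.
have [a Ia spa] := has_ldesc Ip p1.
have [->|/eqP pa] := eqVneq p a.
  by exists a, 1; split; rewrite ?conjg1 //; apply: span1.
have lt := sep_len_conj rp (IS Ia) pa spa.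
have Isa := span_gen Ia.
have [||b [g [Ib Ig e]]] := IHn (p ^ a) (leq_trans lt pn).
- exact: reflJ.
- exact: spanJ.
exists b, (g * a^-1); split => //; first by apply: spanM => //; apply: spanV.
by rewrite conjgM -e conjgK.
Qed.

(** A coset of [span I], other than [span I] itself, contains at most one
    reflection.  Let [O] be the set of all of them.  The cocycle identity shows
    that each member of [O] maps [1] to the other side of the walls of all the
    members.  But the first wall of [O] crossed by a gallery starting at [1]
    belongs to a reflection in [O] that only crosses its own wall of [O]. *)
Lemma coset_refl_unique p q :
  refl p -> refl q -> span I (p * q) -> ~ span I p -> p = q.
Proof.
move=> rp rq Ipq nIp.
pose O o := refl o /\ span I (o * p).
have OO o o' : O o -> O o' -> span I (o * o').
  move=> [ro Io] [ro' Io'].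
  rewrite -[o](mulgK p) -mulgA -[p^-1 * o']invgK invgM invgK (reflV ro').
  by apply: spanM => //; apply: spanV.
have OI o : O o -> ~ span I o.
  move=> [ro Io] /(spanV iI) Io'; apply: nIp.
  by rewrite -(mulKg o p); apply: spanM.
have OJ o o' : O o -> O o' -> O (o' ^ o).
  move=> Oo Oo'; have [ro Io] := Oo; have [ro' Io'] := Oo'.
  split; first exact: reflJ.
  rewrite conjgE (reflV ro) mulgA -[X in span _ X]mulgA.
  by apply: spanM => //; apply: OO.
have Op : O p by split=> //; rewrite (refl_invol rp); apply: span1.
have Oq : O q.
  by split=> //; rewrite -[q * p]invgK invgM (reflV rp) (reflV rq); apply: spanV.
have sOO o o' : O o -> O o' -> sep o o'.
  move=> Oo Oo'; have [ro Io] := Oo; have [ro' Io'] := Oo'.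
  have Oo'' := OJ _ _ Oo Oo'; have [ro'' _] := Oo''.
  have Iw := OO _ _ Oo' Oo.
  have {1}-> : o = (o' * o) * (o' ^ o).
    rewrite conjgE (reflV ro) !mulgA -[o' * o * o]mulgA (refl_invol ro) mulg1.
    by rewrite (refl_invol ro') mul1g.
  rewrite sepM (nsep_span Iw (OI _ Oo')) /= conjgM.
  have -> : o' ^ o' = o' by rewrite conjgE mulKg.
  exact: sep_refl.
(* The first wall of [O] met by a gallery. *)
have cross y : (forall o, O o -> ~~ sep y o) \/
    exists z s, [/\ S s, forall o, O o -> ~~ sep z o & O (s ^ z^-1)].
  elim/span_ind: y / (gen_span H y) => [|y s _ [IHy|IHy] Ss]; last by right.
    by left=> o _; rewrite gsep1.
  have [Os|nOs] := pselect (O (s ^ y^-1)); first by right; exists y, s.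
  left=> o Oo; rewrite (sepMs H) // (negPf (IHy _ Oo)) /=.
  by rewrite conjg_eqV; apply/negP => /eqP e; apply: nOs; rewrite -e.
have [/(_ p Op)|[z [s [Ss nz Os]]]] := cross p; first by rewrite sep_refl.
suff all_s o : O o -> o ^ z = s.
  by apply: (@conjg_inj _ z); rewrite !all_s.
move=> Oo; apply/eqP; have zs : z * s = s ^ z^-1 * z by gsimp.
have := sepMs H z o Ss; rewrite zs sepM sOO // (negPf (nz _ Oo)).
by rewrite (negPf (nz _ (OJ _ _ Os Oo))) addFb => <-.
Qed.

End Parabolic.

(** * Confluence of the galleries leaving a wall *)

(** Let [r] be the wall seen from a chamber, let [b] lead away from it, and let
    [a] not lead closer.  Then all the galleries of the residue of [{a, b}]
    issued from that chamber keep moving away, except where they cross the wall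
    of [a] when [a] commutes with [r]. *)
Section Ascent.
Variables (r a b : W).
Hypotheses (rr : refl r) (Sa : S a) (Sb : S b).
Hypotheses (ra : r <> a) (up_a : len r <= len (r ^ a)) (up_b : len r < len (r ^ b)).
Let I := [set a; b].

Lemma pair_sub x y : S x -> S y -> [set x; y] `<=` S.
Proof. by move=> Sx Sy z [->|->]. Qed.

Let IS : I `<=` S. Proof. exact: pair_sub. Qed.

Let rb : r <> b.
Proof.
move=> e; move: up_b; rewrite e conjgE mulKg ltnn; done.
Qed.

Let nra : ~~ sep r a.
Proof. by apply: contraL up_a => /(sep_len_conj rr Sa ra); rewrite ltnNge. Qed.

Let nrb : ~~ sep r b.
Proof.
by apply: contraL up_b => /(sep_len_conj rr Sb rb)/ltnW; rewrite -leqNgt.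
Qed.

Let rbn : r ^ b <> r.
Proof. by move=> e; move: up_b; rewrite e ltnn. Qed.

Let nsr y : span I y -> ~~ sep r y.
Proof. by apply: nsep_coset => // c [->|->]. Qed.

Lemma ascent_nspan : ~ span I r.
Proof. by move=> /nsr; rewrite sep_refl. Qed.

(** Otherwise the coset of [r] would contain two reflections. *)
Let com y : refl y -> span I (y ^ r) -> span I y -> r ^ y = r.
Proof.
move=> ry Iyr Iy; apply/esym/(@coset_refl_unique I) => //; first exact: reflJ.
  rewrite (_ : r * _ = y ^ r * y); first exact: spanM.
  by rewrite !conjgE (reflV rr) (reflV ry) !mulgA.
exact: ascent_nspan.
Qed.

Let com_desc q c : refl q -> span I q -> r ^ q = r -> I c -> sep q c ->
  r ^ c = r.
Proof.
move=> rq Iq rqr Ic qc; have Icc := span_gen Ic.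
have rc := refl_gen (IS Ic).
apply: com => //; apply: (sep_span IS Iq).
have := sepM r q c; rewrite -(conjg_comm rqr) sepM qc.
have /negPf -> : ~~ sep r (c ^ q) by apply/nsr/spanJ => //; apply: involS.
by have /negPf -> := nsr Icc; rewrite addFb => <-.
Qed.

Let com_eq q : refl q -> span I q -> r ^ q = r -> q = a.
Proof.
move=> rq Iq rqr; apply: contrapT => qa.
have adesc p : refl p -> span I p -> r ^ p = r -> sep p a /\ r ^ a = r.
  move=> rp Ip rpr; have [||c Ic pc] := @has_ldesc I IS p => //.
    exact/eqP/refl_neq1.
  have rcr := com_desc rp Ip rpr Ic pc.
  by case: Ic pc rcr => [->//|->]; move=> _ /rbn.
have [qd rar] := adesc q rq Iq rqr.
have Ia : span I a by apply: span_gen; left.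
have aV := reflV (refl_gen Sa).
have qaE : q ^ a = a * (q * a) by rewrite conjgE aV.
have [||| + _] := adesc (q ^ a).
- exact: reflJ.
- by apply: spanJ => //; apply: involS.
- by rewrite qaE !conjgM rar rqr rar.
have aa : a ^ a = a by rewrite conjgE mulKg.
rewrite qaE !sepM !(sep_gen _ Sa) aa eqxx qd addTb addTb negbK => /eqP aq.
by apply/qa/sep_commute/qd; [|exact: refl_gen|exact: conjg_comm aq].
Qed.

(** The step from [w] to [w * x] crosses the wall of [x ^ w^-1]. *)
Lemma ascent w x : span I w -> I x -> ~~ sep w^-1 x ->
  [/\ r ^ w <> x, len (r ^ w) <= len (r ^ (w * x)) &
      x ^ w^-1 <> a -> len (r ^ w) < len (r ^ (w * x))].
Proof.
move=> Iw Ix nwx; set q := x ^ w^-1; have iI := involS IS.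
have Iq : span I q := (spanJ iI (span_gen Ix) (spanV iI Iw)).
have rq : refl q by apply: reflJ; apply/refl_gen/IS.
have rw : refl (r ^ w) by apply: reflJ.
have nwq : ~~ sep w q by rewrite -sepV.
have nIrw : ~ span I (r ^ w).
  move=> /(spanJ iI)/(_ (spanV iI Iw)); rewrite conjgK; exact: ascent_nspan.
have rwx : r ^ w <> x by move=> e; apply: nIrw; rewrite e; apply: span_gen.
(* Otherwise [q ^ r] is in [span I]; then [q] commutes with [r], and [w] has
   already crossed the wall of [q]. *)
have nsep : ~~ sep (r ^ w) x.
  rewrite conjgE !sepM (negPf nwx) -/q (negPf (nsr Iq)) /=.
  apply/negP => swq; have Iqr := sep_span IS Iw swq.
  have rqr := com rq Iqr Iq.
  by move: swq; rewrite (conjg_comm_sym rqr) (negPf nwq).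
rewrite conjgM; split; [exact: rwx|exact: (nsep_len_conj_le rw (IS Ix))|].
move=> qa; rewrite (nsep_len_conj rw (IS Ix) nsep) ?leqnSn //.
move=> e; apply/qa/com_eq => //.
have qE : q = w * (x * w^-1) by rewrite /q conjgE invgK.
by rewrite qE !conjgM e conjgK.
Qed.

End Ascent.

Lemma nxt_pair a b n : [set a; b] (nxt a b n).
Proof. by rewrite /nxt; case: odd; [right|left]. Qed.

Lemma pairC a b : [set a; b] = [set b; a].
Proof. exact: setUC. Qed.

Lemma span_alt a b n : span [set a; b] (alt a b n).
Proof.
elim: n => [|n IHn]; first exact: span1.
rewrite altS; apply: spanMr => //; exact: nxt_pair.
Qed.

Lemma span_alt' a b n : span [set a; b] (alt b a n).
Proof. by rewrite pairC; apply: span_alt. Qed.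

Section Alt.
Variables a b : W.
Hypotheses (Sa : S a) (Sb : S b).
Let aa := gen_invol H Sa.
Let bb := gen_invol H Sb.

Lemma alt_crossed n : nxt a b n ^ (alt a b n)^-1 = (a * b) ^+ n * a.
Proof. by rewrite conjgE invgK mulgA -altS alt_wall // mulgK. Qed.

Lemma nsep_alt n t : (forall j, j < n -> t <> (a * b) ^+ j * a) ->
  sep (alt a b n) t = false.
Proof.
elim: n => [|n IHn] tn; first exact: gsep1.
rewrite altS (sepMs H); last by apply: (pair_sub Sa Sb); apply: nxt_pair.
rewrite IHn => [|j jn]; last by apply: tn; apply: ltnW.
by rewrite conjg_eqV alt_crossed; apply/eqP/tn.
Qed.

(** An alternating word is reduced as long as the order of [a * b] is not
    exceeded, since the walls it crosses are distinct. *)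
Lemma alt_up n : (forall j, 0 < j <= n -> (a * b) ^+ j <> 1) ->
  ~~ sep (alt a b n)^-1 (nxt a b n).
Proof.
move=> nrel; rewrite sepV alt_crossed nsep_alt // => j jn /mulIg e.
apply: (nrel (n - j)); first by rewrite subn_gt0 jn leq_subr.
by rewrite expgnFr ?(ltnW jn) // e mulgV.
Qed.

End Alt.

(** Chambers are followed while they move away from the wall of [t].  The goal
    set [A] consists of chambers at distance at least [n], and it is stable under
    the moves that stay at distance at least [n]: passing to an adjacent chamber,
    and jumping inside an infinite rank two residue which the wall of [t] does
    not cross.  Ascending galleries are confluent, so that whether [A] can be
    reached does not depend on the starting chamber within a half-space. *)
Section Confluence.
Variables (t : W) (A : W -> Prop) (n : nat).
Hypothesis rt : refl t.
Local Notation D z := (len (t ^ z)).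
Hypothesis A0 : forall z, A z -> n <= D z.
Hypothesis A1 : forall z s, S s -> A z -> n <= D (z * s) -> A (z * s).
Hypothesis A2 : forall z a b w, S a -> S b -> A z ->
  (forall k, 0 < k -> (a * b) ^+ k <> 1) -> ~ span [set a; b] (t ^ z) ->
  span [set a; b] w -> n <= D (z * w) -> A (z * w).

Inductive ascend : W -> W -> Prop :=
| ascend0 z : ascend z z
| ascendS z s z' : S s -> D z < D (z * s) -> ascend (z * s) z' -> ascend z z'.

Definition reaches z := exists2 z', A z' & ascend z z'.

Lemma ascend_step x y s : ascend x y -> S s -> D y < D (y * s) ->
  ascend x (y * s).
Proof.
move=> xy Ss lt; elim: xy lt => [z lt|z u z' Su zzu _ IH lt].
  by apply: ascendS lt _ => //; apply: ascend0.
by apply: ascendS zzu _ => //; apply: IH.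
Qed.

Lemma reaches_ascend x y : ascend x y -> reaches y -> reaches x.
Proof.
move=> xy ry; elim: xy ry => // z s z' Ss lt _ IH /IH [v Av sv].
by exists v => //; apply: ascendS sv.
Qed.

Lemma reaches_high z : n <= D z -> reaches z -> A z.
Proof.
move=> + [z' + zz']; elim: zz' => // {z'}z s z' Ss lt _ IH nz Az'.
have Azs : A (z * s) by apply: IH Az'; apply: leq_trans nz (ltnW lt).
have := A1 Ss Azs; rewrite -mulgA (gen_invol H Ss) mulg1; exact.
Qed.

Lemma reaches_A z : A z -> reaches z.
Proof. by move=> Az; exists z => //; apply: ascend0. Qed.

(** Induction on the distance left to [n].  An ascending gallery from [z] begins
    with some [s'].  If the residue of [{s, s'}] is finite, then the two ways
    around it meet at the opposite chamber and every step but possibly one at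
    each end ascends.  If it is infinite, then both ways ascend for ever, and the
    second stability property links them. *)
Lemma confluence_up k z s : S s -> t ^ z <> s -> n <= D z + k ->
  D z <= D (z * s) -> reaches z -> reaches (z * s).
Proof.
elim: k z s => [|k IHk] z s Ss tzs nk up rz.
  rewrite addn0 in nk; apply/reaches_A/A1 => //; first exact: reaches_high.
  exact: leq_trans up.
have [nz|zn] := leqP n (D z).
  by apply/reaches_A/A1 => //; [exact: reaches_high|exact: leq_trans up].
case: rz => z' Az' zz'; case: zz' Az' zn nk up tzs => {z'} [{}z|{}z s' z' Ss' lt az'] Az'.
  by rewrite ltnNge A0.
move=> zn nk up tzs.
have rz' : reaches (z * s') by exists z'.
have [<-//|/eqP ss'] := eqVneq s' s.
pose r := t ^ z; have rr : refl r by apply: reflJ.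
have Dr w : D (z * w) = len (r ^ w) by rewrite conjgM.
have := ascent rr Ss Ss' tzs; rewrite -!Dr => /(_ up lt) asc.
pose I := [set s; s'].
have ssss := gen_invol H Ss; have ss's' := gen_invol H Ss'.
have step' j : (forall i, 0 < i <= j -> (s' * s) ^+ i <> 1) ->
    [/\ t ^ (z * alt s' s j) <> nxt s' s j,
        D (z * alt s' s j) <= D (z * alt s' s j.+1) &
        (s' * s) ^+ j.+1 <> 1 ->
        D (z * alt s' s j) < D (z * alt s' s j.+1)].
  move=> nrel; have := alt_up Ss' Ss nrel.
  have Inx : I (nxt s' s j) by rewrite /I pairC; apply: nxt_pair.
  move=> /(asc _ _ (span_alt' s s' j) Inx) [e1 e2 e3].
  rewrite altS !Dr conjgM; split => // ne; apply: e3.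
  rewrite alt_crossed // => e; apply: ne.
  by rewrite expgSr mulgA e.
have step j : 0 < j -> (forall i, 0 < i <= j -> (s * s') ^+ i <> 1) ->
    D (z * alt s s' j) < D (z * alt s s' j.+1).
  move=> j0 nrel; have := alt_up Ss Ss' nrel.
  move=> /(asc _ _ (span_alt s s' j) (nxt_pair _ _ _)) [_ _ e3].
  rewrite altS !Dr; apply: e3; rewrite alt_crossed // => e.
  apply: (nrel j); first by rewrite j0 leqnn.
  by apply: (@mulIg _ s); rewrite mul1g.
have ray' j : (forall i, 0 < i <= j -> (s' * s) ^+ i <> 1) ->
    D z < D (z * alt s' s j.+1) /\ reaches (z * alt s' s j.+1).
  elim: j => [|j IHj] nrel; first by rewrite /= mulg1.
  have [i /andP[i0 ij]|zj rj] := IHj; first by apply: nrel; rewrite i0 leqW.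
  have [e1 e2 _] := step' _ nrel; split; first exact: leq_trans e2.
  rewrite altS mulgA; apply: IHk => //.
  - exact/(pair_sub Ss' Ss)/nxt_pair.
  - rewrite (leq_trans nk) // addnS -addSn leq_add2r //.
  - by rewrite -mulgA -altS.
have ray j : (forall i, 0 < i <= j -> (s * s') ^+ i <> 1) ->
    D z + j <= D (z * alt s s' j.+1) /\ ascend (z * s) (z * alt s s' j.+1).
  elim: j => [|j IHj] nrel.
    by rewrite /= mulg1 addn0; split => //; apply: ascend0.
  have [i /andP[i0 ij]|zj rj] := IHj; first by apply: nrel; rewrite i0 leqW.
  have st := step j.+1 isT nrel; split.
    by rewrite addnS; apply: leq_ltn_trans st.
  rewrite altS mulgA; apply: ascend_step => //; last by rewrite -mulgA -altS.
  exact/(pair_sub Ss Ss')/nxt_pair.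
have [[k0 [k0_gt0 k0P]]|inf] := pselect (exists k, 0 < k /\ (s' * s) ^+ k = 1).
  have exm : exists k, (0 < k) && `[< (s' * s) ^+ k = 1 >].
    by exists k0; rewrite k0_gt0; apply/asboolP.
  case: (ex_minnP exm) => -[//|m] /andP[_ /asboolP mP] min_m.
  have nrel i : 0 < i <= m -> (s' * s) ^+ i <> 1.
    by move=> /andP[i0 im] e; have := min_m i; rewrite i0 ltnNge im (asboolT e) => /(_ isT).
  have nrel' i : 0 < i <= m -> (s * s') ^+ i <> 1.
    move=> /nrel; rewrite (expg_inv _ ssss ss's') => + e; apply.
    by rewrite e invg1.
  apply: reaches_ascend (ray m nrel').2 _.
  have := (ray' m nrel).2; rewrite alt_expg // mP mul1g.
  done.
have nrel i : 0 < i -> (s' * s) ^+ i <> 1 by move=> i0 e; apply: inf; exists i.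
have nrel' i : 0 < i -> (s * s') ^+ i <> 1.
  move=> /nrel; rewrite (expg_inv _ ssss ss's') => + e; apply.
  by rewrite e invg1.
have grow j : D z + j <= D (z * alt s' s j.+1).
  elim: j => [|j IHj]; first by rewrite addn0 /= mulg1 ltnW.
  have [|_ _] := step' j.+1; first by move=> i /andP[/nrel].
  by rewrite addnS => /(_ (nrel j.+2 isT)); apply: leq_ltn_trans.
have [|_ rn] := ray' n; first by move=> i /andP[/nrel].
have An := reaches_high (leq_trans (leq_addl _ _) (grow n)) rn.
have [|zn' azn] := ray n; first by move=> i /andP[/nrel'].
apply: (reaches_ascend azn); apply: reaches_A.
have iI : invols I by apply/involS/pair_sub.
have Ialt := span_alt' s s' n.+1.
have zE : z * alt s s' n.+1 =
    (z * alt s' s n.+1) * ((alt s' s n.+1)^-1 * alt s s' n.+1).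
  by rewrite -(mulgA z) mulVKg.
have Dn : n <= D (z * alt s s' n.+1).
  exact: leq_trans (leq_addl _ _) zn'.
rewrite zE in Dn *; apply: (@A2 _ s s') Dn => //; rewrite -/I.
  rewrite conjgM => /(spanJ iI)/(_ (spanV iI Ialt)); rewrite conjgK.
  by apply: (@ascent_nspan r s s') => //; rewrite -Dr.
by apply: spanM; [apply: spanV|apply: span_alt].
Qed.

Lemma confluence z s : S s -> t ^ z <> s -> reaches z -> reaches (z * s).
Proof.
move=> Ss tzs rz; have [le|lt] := leqP (D z) (D (z * s)).
  by apply: (@confluence_up n) => //; apply: leq_addl.
have zE : z = z * s * s by rewrite -mulgA (gen_invol H Ss) mulg1.
apply: (@reaches_ascend _ z) rz; apply: (@ascendS _ s) => //; rewrite -zE //.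
exact: ascend0.
Qed.

(** Half-spaces are connected by galleries. *)
Lemma reaches_half_space y z : sep y t = sep z t -> reaches y -> reaches z.
Proof.
move=> + ry; rewrite -(mulVKg y z) sepM; move: (y^-1 * z) => x.
have [m] := ubnP (len x); elim: m x y ry => // m IHm x y ry; rewrite ltnS => xm e.
have [->|/eqP x1] := eqVneq x 1; first by rewrite mulg1.
have [a Sa xa] := @has_ldesc S (@subset_refl _ S) x (gen_span H x) x1.
have tya : t ^ y <> a by move=> ya; move: e; rewrite ya xa; case: sep.
have aa := gen_invol H Sa.
have -> : y * x = y * a * (a * x) by rewrite !mulgA -[y * a * a]mulgA aa mulg1.
apply: IHm; first exact: confluence.
  by apply: leq_trans xm; rewrite (len_down Sa xa).
have xE : x = a * (a * x) by rewrite mulgA aa mul1g.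
have := sepM a (a * x) (t ^ y); rewrite -xE (sep_gen _ Sa) -conjgM.
move/eqP: tya => /negPf -> /= e2; move: e; rewrite e2.
by case: (sep (a * x) _); case: (sep y t); case: (sep (y * a) t).
Qed.

End Confluence.

(** * Reflections with finitely or infinitely many conjugates *)

Definition conj_class t := [set t ^ x | x in [set: W]].

Section FiniteRank.
Hypothesis S_fin : finite_set S.

Lemma finite_ball n : finite_set [set w | len w < n].
Proof.
elim: n => [|n IHn]; first by apply: (@finite_sub_seq _ _ [::]).
apply: (@sub_finite_set _ _ ([set 1] `|` [set s * w | s in S & w in [set w | len w < n]])).
  move=> w /=; rewrite ltnS => wn.
  have [->|/eqP w1] := eqVneq w 1; [by left|right].
  have [a Sa wa] := @has_ldesc S (@subset_refl _ S) w (gen_span H w) w1.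
  exists a => //; exists (a * w); first by rewrite -(len_down Sa wa).
  by rewrite mulgA (gen_invol H Sa) mul1g.
by rewrite finite_setU; split; [exact: finite_set1|exact: finite_image2].
Qed.

Lemma infinite_class_long t n : ~ finite_set (conj_class t) ->
  exists x, n <= len (t ^ x).
Proof.
move=> inf; apply: contrapT => none; apply: inf.
apply: sub_finite_set (finite_ball n) => _ [x _ <-] /=.
by rewrite ltnNge; apply/negP => nx; apply: none; exists x.
Qed.

Lemma lenM_le x y : len (x * y) <= len x + len y.
Proof.
apply: len_le; move: (len_wordn y); move: (len y) => m; elim=> {y m} [|n w s _ IH Ss].
  by rewrite addn0 mulg1; apply: len_wordn.
by rewrite addnS mulgA; constructor.
Qed.

Lemma lenJ_le t x : len (t ^ x) <= len t + (len x).*2.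
Proof.
rewrite conjgE (leq_trans (lenM_le _ _)) // lenV -addnn addnCA leq_add2l.
exact: lenM_le.
Qed.

(** A group is not a finite union of cosets of subgroups of infinite index
    (B. H. Neumann); the subgroups are the centralizers of the elements of a
    list, and the chambers near the wall of [t] form finitely many cosets of the
    centralizer of [t]. *)
Lemma deep_chamber (L : seq W) n :
  (forall t, t \in L -> ~ finite_set (conj_class t)) ->
  exists x, forall t, t \in L -> n <= len (t ^ x).
Proof.
elim: L n => [|t L IHL] n infL; first by exists 1.
apply: contrapT => none.
have short x : exists2 u, u \in t :: L & len (u ^ x) < n.
  apply: contrapT => nx; apply: none; exists x => u uL.
  by rewrite leqNgt; apply/negP => ux; apply: nx; exists u.
have [y ty] : exists y, n <= len (t ^ y).
  by apply/infinite_class_long/infL; rewrite mem_head.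
pose g u := xget 1 [set x | t ^ x = u].
have [M MP] := finite_bound (fun u => len (g u)) (finite_ball n).
have [u uL|x xP] := IHL (n + (len y + M).*2).
  by apply: infL; rewrite in_cons uL orbT.
have far u : u \in L -> ~~ (len (u ^ x) < n).
  by move=> /xP le; rewrite -leqNgt (leq_trans _ le) // leq_addr.
have [u] := short x; rewrite in_cons => /orP[/eqP -> tx|/far/negP//].
have gx : t ^ g (t ^ x) = t ^ x by apply: (@xgetPex _ 1 [set v | t ^ v = _]); exists x.
have lt := MP _ tx; set v := g _ in gx lt.
have [w] := short (x * v^-1 * y); rewrite in_cons => /orP[/eqP ->|wL wlt].
  by rewrite !conjgM -gx conjgK ltnNge ty.
have := xP w wL; rewrite leqNgt => /negP; apply.
have -> : x = x * v^-1 * y * (y^-1 * v) by gsimp.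
rewrite conjgM (leq_ltn_trans (lenJ_le _ _)) //.
rewrite -addSn leq_add // leq_double (leq_trans (lenM_le _ _)) // lenV leq_add2l.
exact: ltnW.
Qed.

End FiniteRank.

Lemma conj_classJ t x : conj_class t (t ^ x).
Proof. by exists x. Qed.

(** Peeling off the letters of [u] makes [b] a left descent; [Q] records what the
    peeling preserves. *)
Lemma reduced_letter (Q : W -> Prop) m u b v :
  (forall x a, Q x -> S a -> sep x a -> Q (a * x)) ->
  Q m -> S b -> m = u * b * v -> len m = (len u + len v).+1 ->
  exists2 x, Q x & sep x b.
Proof.
move=> Qdel + Sb; have [n] := ubnP (len u).
elim: n m u => // n IHn m u; rewrite ltnS => un Qm mE lm.
have [u1|/eqP u1] := eqVneq u 1.
  exists m => //; apply: contraT => /(len_up Sb).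
  rewrite mE u1 mul1g len1 add0n in lm *.
  rewrite mulgA (gen_invol H Sb) mul1g => lv.
  suff : len v < len v by rewrite ltnn.
  by rewrite {2}lv lm ltnS leqnSn.
have [a Sa ua] := @has_ldesc S (@subset_refl _ S) u (gen_span H u) u1.
have lu := len_down Sa ua.
have amE : a * m = a * u * b * v by rewrite mE !mulgA.
have ma : sep m a.
  apply: contraT => /(len_up Sa); rewrite amE => lam.
  have := lenM_le (a * u * b) v; rewrite lam lm lu leqNgt => /negP[].
  rewrite ltnS (leq_trans (leq_add (lenM_le _ _) (leqnn _))) //.
  have -> : len b = 1%N.
    have := @len_up b 1 Sb; rewrite gsep1 mulg1 len1; exact.
  by rewrite addn1 addSn ltnW.
apply: (IHn (a * m) (a * u)) => //; first by rewrite -lu.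
- exact: Qdel.
- by apply: succn_inj; rewrite -len_down // lm lu.
Qed.

Lemma letter_in_span I m u b v : I `<=` S -> span I m -> S b ->
  m = u * b * v -> len m = (len u + len v).+1 -> I b.
Proof.
move=> IS Im Sb mE lm; have [|x Ix xb] := reduced_letter _ Im Sb mE lm.
  move=> x a Ix Sa /(sep_span IS Ix) Ia; exact: spanM.
exact: (gen_in_span IS Sb (sep_span IS Ix xb)).
Qed.

Section FiniteClass.
Variable r : W.
Hypotheses (Sr : S r) (r_fin : finite_set (conj_class r)).
Let O := conj_class r.

Let OJ o x : O o -> O (o ^ x).
Proof. by move=> [y _ <-]; rewrite -conjgM; apply: conj_classJ. Qed.

(** The kernel of the action of the group on the half-spaces bounded by the
    finitely many walls in the class of [r]. *)
Let N0 n := forall o, O o -> o ^ n = o /\ sep n o = false.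

Let N0J n x : N0 n -> N0 (n ^ x).
Proof.
move=> Nn o Oo; have [e1 e2] := Nn (o ^ x^-1) (OJ _ Oo); split.
  by rewrite conjg_conj e1 conjgKV.
by rewrite [n ^ x]conjgE !sepM e2 sepV e1 addFb addbb.
Qed.

(** The letters of a reduced word of [n] are conjugates of walls separating [1]
    from [n]. *)
Let avoid n : (forall o, O o -> sep n o = false) -> span (S `\` O) n.
Proof.
have [m] := ubnP (len n); elim: m n => // m IHm n; rewrite ltnS => nm Nn.
have [->|/eqP n1] := eqVneq n 1; first exact: span1.
have [a Sa na] := @has_ldesc S (@subset_refl _ S) n (gen_span H n) n1.
have nOa : ~ O a by move=> /Nn; rewrite na.
have aa := gen_invol H Sa.
have -> : n = a * (a * n) by rewrite mulgA aa mul1g.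
apply: spanM; first by apply: span_gen.
apply: IHm => [|o Oo]; first by apply: leq_trans nm; rewrite (len_down Sa na).
rewrite sepM sep_gen // (Nn _ (OJ _ Oo)) addbF.
by apply/eqP => oa; apply: nOa; rewrite -oa.
Qed.

(** The letters of the reduced words of the elements of the kernel. *)
Let B b := S b /\ exists n u v,
  [/\ N0 n, n = u * b * v & len n = (len u + len v).+1].

Let BS : B `<=` S. Proof. by move=> b []. Qed.
Let iB := involS BS.

Let N0_B n : N0 n -> span B n.
Proof.
move=> Nn; suff sfx u v : n = u * v -> len n = len u + len v -> span B v.
  by apply: (sfx 1); rewrite ?mul1g // len1.
have [m] := ubnP (len v); elim: m u v => // m IHm u v; rewrite ltnS => vm nE ln.
have [->|/eqP v1] := eqVneq v 1; first exact: span1.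
have [a Sa va] := @has_ldesc S (@subset_refl _ S) v (gen_span H v) v1.
have vE : v = a * (a * v) by rewrite mulgA (gen_invol H Sa) mul1g.
have lv := len_down Sa va.
have nE' : n = u * a * (a * v) by rewrite nE {1}vE !mulgA.
have ln' : len n = (len u + len (a * v)).+1 by rewrite ln lv addnS.
have Ba : B a by split=> //; exists n, u, (a * v).
rewrite vE; apply: spanM; first exact: span_gen.
apply: (IHm (u * a)) => //; first by rewrite -lv.
apply/eqP; rewrite eqn_leq {1}nE' lenM_le /= ln' -addSn leq_add2r.
by rewrite -lenV -[len u]lenV invgM (reflV (refl_gen Sa)) lenMs_le.
Qed.

Let rNB : ~ B r.
Proof.
move=> [_ [n [u [v [Nn nE ln]]]]].
have In := avoid (fun o Oo => (Nn o Oo).2).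
have [_ []] := letter_in_span (@subDsetl _ S O) In Sr nE ln.
by exists 1; rewrite ?conjg1.
Qed.

(** The kernel is normal.  Hence [c * n * c] is again spanned by [B] for every
    [n] in the kernel, which forces [n * c = c * n] as [c] lies outside [B], and
    then [c] commutes with all the letters of [n]. *)
Let B_comm c b : S c -> ~ B c -> B b -> c ^ b = c.
Proof.
move=> Sc nBc [Sb [n [u [v [Nn nE ln]]]]].
have cc := gen_invol H Sc; have cV := reflV (refl_gen Sc).
have nspan m : span B m -> sep m c = false.
  move=> Bm; apply: (nsep_span BS Bm) => /(gen_in_span BS Sc); exact: nBc.
have comm_desc m a : span B m -> c ^ m = c -> B a -> sep m a -> c ^ a = c.
  move=> Bm cm Ba ma; have ra := refl_gen (BS Ba).
  apply/esym/(coset_refl_unique BS (refl_gen Sc)); first exact/reflJ/refl_gen.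
    rewrite (_ : c * _ = a ^ c * a); last first.
      by rewrite !conjgE cV (reflV ra) !mulgA.
    apply: spanM; last exact: span_gen.
    apply: (sep_span BS Bm).
    have com : c * m = m * c by rewrite (conjg_comm cm).
    have := sepM m c a; rewrite -com sepM ma !(sep_gen _ Sc).
    have -> : a == c = false by apply/eqP => ac; apply: nBc; rewrite -ac.
    have -> : a ^ m == c = false.
      apply/eqP => ac; apply/nBc/(gen_in_span BS Sc); rewrite -ac.
      by apply: spanJ => //; apply: span_gen.
    by rewrite addFb => ->.
  by move=> /(gen_in_span BS Sc); apply: nBc.
(* [c] commutes with the element [n] of the kernel. *)
have Bn := N0_B Nn.
have cn : c ^ n = c.
  have Bn' := N0_B (N0J c Nn); set n' := n ^ c in Bn'.
  have cnE : c * n = n' * c by rewrite /n' conjgE cV -!mulgA cc mulg1.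
  have := sepM c n c; rewrite cnE (sepMs H) // (sep_gen _ Sc) eqxx (nspan _ Bn').
  rewrite [c ^ c]conjgE mulKg (nspan _ Bn) /= => /eqP cn'.
  have nn' : n = n' by apply: (@mulgI _ c); rewrite cnE (conjg_comm cn').
  by rewrite {1}nn'.
have [||x [Bx cx] xb] :=
    @reduced_letter (fun x => span B x /\ c ^ x = c) n u b v _ _ Sb nE ln.
- move=> x a [Bx cx] Sa xa.
  have Ba : B a by apply: (gen_in_span BS Sa (sep_span BS Bx xa)).
  split; first by apply: spanM => //; apply: span_gen.
  by rewrite conjgM (comm_desc _ _ Bx cx Ba xa).
- by split.
apply: (comm_desc x) => //; split => //; by exists n, u, v.
Qed.

(** A generator with finitely many conjugates lies in a finite direct factor
    spanned by generators: the complement [X] of [B] commutes with [B], and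
    [span X] acts faithfully on the half-spaces of the class because the kernel
    lies in [span B]. *)
Lemma finite_class_factor : exists X : set W, [/\ X `<=` S, X r,
  forall x b, X x -> S b -> ~ X b -> x ^ b = x & finite_set (span X)].
Proof.
pose X := S `\` B.
have XS : X `<=` S by move=> x [].
exists X; split => //.
  by move=> x b [Sx nBx] Sb nXb; apply: B_comm => //; apply: contrapT => nBb; apply: nXb.
have [Os OsE] := (finite_seqP O).1 r_fin.
have OsP o : O o <-> o \in Os by rewrite OsE.
have Or : r \in Os by apply/OsP; exists 1; rewrite ?conjg1.
(* The action of [w] on the half-spaces of the class. *)
pose f w : {ffun seq_sub Os -> seq_sub Os * bool} :=
  [ffun o => (insubd (SeqSub Or) (val o ^ w), sep w (val o))].
apply: (@finite_inj _ _ _ f) => x y Xx Xy fxy.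
have iX := involS XS.
have Nxy : N0 (x * y^-1).
  move=> o /[dup] Oo /OsP oOs.
  have /ffunP/(_ (SeqSub oOs)) := fxy; rewrite !ffunE /= => -[/(congr1 val)].
  rewrite !insubdK; [|by apply/OsP/OJ|by apply/OsP/OJ] => e1 e2.
  by rewrite conjgM e1 conjgK sepM e1 sepV conjgK e2 addbb.
have Xn : span X (x * y^-1) by apply: spanM => //; apply: spanV.
apply/eqP; rewrite -divg_eq1; apply/eqP; apply: contrapT.
move=> /(has_ldesc BS (N0_B Nxy)) [b Bb nb].
by have [] := gen_in_span XS (BS Bb) (sep_span XS Xn nb).
Qed.

End FiniteClass.

Lemma factor_class X x : X `<=` S -> X x ->
  (forall x b, X x -> S b -> ~ X b -> x ^ b = x) -> finite_set (span X) ->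
  finite_set (conj_class x).
Proof.
move=> XS Xx Xcom; apply: sub_finite_set => _ [w _ <-].
elim/span_ind: w / (gen_span H w) => [|w s _ IHw Ss].
  by rewrite conjg1; apply: span_gen.
rewrite conjgM; have [Xs|nXs] := pselect (X s).
  by apply: spanJ => //; [apply: involS|apply: span_gen].
suff -> : (x ^ w) ^ s = x ^ w by [].
elim/span_ind: (x ^ w) / IHw => [|u y _ IHu Xy]; first by rewrite conj1g.
by rewrite conjMg IHu Xcom.
Qed.

(** An element with two left descents inverts the whole dihedral subgroup they
    generate; only its first walls are needed. *)
Lemma two_desc x y v : S x -> S y -> x <> y -> sep v x -> sep v y ->
  sep v (x ^ y) /\ (x ^ y <> x -> sep v (y ^ (x * y))).
Proof.
move=> Sx Sy xy vx vy; have IS := pair_sub Sx Sy.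
have xx := gen_invol H Sx; have yy := gen_invol H Sy.
have xny : x == y = false by apply/eqP.
have ynx : y == x = false by rewrite eq_sym.
have cJ z : z ^ z = z by rewrite conjgE mulKg.
have v1 : sep v (x ^ y).
  apply: contraT => nv.
  have nyv : forall z, span [set x; y] z -> ~~ sep (y * v) z.
    apply: nsep_coset => // z [->|->].
      by rewrite sepM sep_gen // xny.
    by rewrite sepM sep_gen // eqxx cJ vy.
  move: vx; have -> : v = y * (y * v) by rewrite mulgA yy mul1g.
  rewrite sepM sep_gen // xny addFb => yvx.
  suff: ~~ sep (y * v) (x ^ y) by rewrite yvx.
  apply: nyv; by apply: spanJ; [apply: involS|apply: span_gen; left|apply: span_gen; right].
split=> // xcy; apply: contraT => nv.
have ycx : y ^ x == y = false by apply/eqP => /conjg_comm_sym.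
have nu : forall z, span [set x; y] z -> ~~ sep (x * (y * v)) z.
  apply: nsep_coset => // z [->|->].
    by rewrite !sepM (sep_gen _ Sx) (sep_gen _ Sy) eqxx cJ xny v1.
  by rewrite !sepM (sep_gen _ Sx) (sep_gen _ Sy) ynx ycx -conjgM (negPf nv).
move: vx; have -> : v = y * (x * (x * (y * v))).
  by rewrite (mulgA x x) xx mul1g mulgA yy mul1g.
move/eqP: xcy => /negPf xcy.
rewrite sepM sep_gen // xny sepM sep_gen // xcy !addFb => xvx.
have [Ix Iy] : span [set x; y] x /\ span [set x; y] y.
  by split; apply: span_gen; [left|right].
suff: ~~ sep (x * (y * v)) ((x ^ y) ^ x) by rewrite xvx.
by apply: nu; apply: spanJ => //; [apply: involS|apply: spanJ => //; apply: involS].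
Qed.

(** Along a walk without backtracking in the diagram no braid relation ever
    applies, so that the products of the letters have a single descent and their
    lengths grow. *)
Section Walk.
Variable c : nat -> W.
Hypotheses (Sc : forall n, S (c n)) (c_step : forall n, c n ^ c n.+1 <> c n).
Hypothesis c_nback : forall n, c n.+2 <> c n.

Fixpoint walk n : W := if n is m.+1 then c m * walk m else 1.

Lemma walk_desc n : (forall s, S s -> sep (walk n.+1) s -> s = c n) /\
  len (walk n.+1) = n.+1.
Proof.
elim/ltn_ind: n => -[|n] IH.
  rewrite /= mulg1; split; first by move=> s _; rewrite sep_gen // => /eqP.
  by have := @len_up (c 0) 1 (Sc 0); rewrite gsep1 mulg1 len1; apply.
have prev : sep (walk n) (c n.+1) = false.
  case: n IH => [|n] IH; first exact: gsep1.
  have [IHd _] := IH n (ltnW (ltnSn _)).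
  by apply/negP => /(IHd _ (Sc _)); apply: c_nback.
have [IHd IHl] := IH n (ltnSn n).
set y := c n.+1; set v := walk n.+2.
have vE : v = y * walk n.+1 by [].
have Sx : S (c n) := Sc n; have Sy : S y := Sc n.+1.
have yy := gen_invol H Sy; have xx := gen_invol H Sx.
have xy : c n <> y by move=> e; apply: (@c_step n); rewrite -/y e conjgE mulKg.
have nv'y : ~~ sep (walk n.+1) y by apply/negP => /(IHd y Sy) /esym /xy.
have lv : len v = n.+2 by rewrite vE (len_up Sy nv'y) IHl.
have vy : sep v y by rewrite vE sep_mul_refl //; apply: refl_gen.
split => // s Ss vs; apply: contrapT => sy; rewrite -/y in sy.
have [vsy _] := two_desc Ss Sy sy vs vy.
have yvE : walk n.+1 = y * v by rewrite vE mulgA yy mul1g.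
have sx : s = c n.
  apply: IHd => //; rewrite yvE sepM sep_gen // vsy addbT.
  by move/eqP: sy => /negPf ->.
have xcy : s ^ y <> s by rewrite sx; apply: c_step.
have [_ /(_ xcy)] := two_desc Ss Sy sy vs vy; rewrite sx => vyxy.
have wE : walk n = c n * (y * v) by rewrite -yvE /= mulgA xx mul1g.
move: prev; rewrite -/y wE (sepM (c n)) (sepM y v) (sep_gen _ Sx) (sep_gen _ Sy).
rewrite -conjgM vyxy addbT.
have -> : y == c n = false by apply/eqP => /esym.
by rewrite addFb => /negbFE /eqP /conjg_comm_sym; rewrite -sx.
Qed.

Lemma walk_infinite X : X `<=` S -> (forall n, X (c n)) -> ~ finite_set (span X).
Proof.
move=> XS Xc; apply: (@inj_not_finite _ _ walk) => [m n|n].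
  have lw k : len (walk k) = k.
    by case: k => [|k]; [exact: len1|have [] := walk_desc k].
  by move=> /(congr1 len); rewrite !lw.
elim: n => [|n IHn]; first exact: span1.
by apply: spanM => //; apply: span_gen.
Qed.

End Walk.

(** * Pairs of reflections *)

(** A dihedral group preserves its rotation up to inversion. *)
Lemma span_conj_inv s s' w : S s -> S s' -> span [set s; s'] w ->
  (s * s') ^ w = s * s' \/ (s * s') ^ w = s' * s.
Proof.
move=> Ss Ss'; have ss := gen_invol H Ss; have ss' := gen_invol H Ss'.
have sV := invol_inv ss; have sV' := invol_inv ss'.
elim/span_ind => [|{}w y _ IHw [->|->]]; first by left; rewrite conjg1.
  rewrite conjgM; case: IHw => ->; [right|left]; rewrite conjgE sV.
    by rewrite !mulgA ss mul1g.
  by rewrite -!mulgA ss mulg1.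
rewrite conjgM; case: IHw => ->; [right|left]; rewrite conjgE sV'.
  by rewrite -!mulgA ss' mulg1.
by rewrite !mulgA ss' mul1g.
Qed.

(** If the product of two reflections is conjugate to [s * s'], then some chamber
    has both walls: after conjugation [coset_refl_unique] puts [p] and [q] into
    the dihedral group of [s] and [s'], where one of them can be made simple. *)
Lemma conj_pair p q d s s' : refl p -> refl q -> p <> q -> S s -> S s' ->
  (p * q) ^ d = s * s' ->
  exists c a b, [/\ S a, S b, p ^ c = a & q ^ c = b].
Proof.
move=> rp rq pq Ss Ss' pqd; set I := [set s; s'].
have IS : I `<=` S := pair_sub Ss Ss'; have iI := involS IS.
have ss := gen_invol H Ss; have ss' := gen_invol H Ss'.
have sV := invol_inv ss; have sV' := invol_inv ss'.
have Ip : span I (p ^ d).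
  apply: contrapT => nIp; apply: pq; apply: (@conjg_inj _ d).
  apply: (coset_refl_unique IS) nIp; [exact: reflJ|exact: reflJ|].
  rewrite -conjMg pqd; apply: spanM; apply: span_gen; [by left|by right].
have [a [g [Ia Ig pE]]] := refl_in_span IS (reflJ d rp) Ip.
have pE' : p ^ (d * g^-1) = a by rewrite conjgM pE conjgK.
have qE : q ^ (d * g^-1) = a * (s * s') ^ g^-1.
  rewrite -pE' -pqd -conjgM -conjMg mulgA.
  by rewrite (refl_invol rp) mul1g.
set c := d * g^-1 in pE' qE.
have := span_conj_inv Ss Ss' (spanV iI Ig).
case: Ia pE' qE => -> pE' qE [uE|uE]; rewrite {}uE in qE.
- by exists c, s, s'; split => //; rewrite qE mulgA ss mul1g.
- exists (c * s), s, s'; split => //; rewrite conjgM ?pE' ?qE conjgE sV.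
    by rewrite mulgA ss mul1g.
  by rewrite -!mulgA ss mulg1 mulgA ss mul1g.
- exists (c * s'), s', s; split => //; rewrite conjgM ?pE' ?qE conjgE sV'.
    by rewrite mulgA ss' mul1g.
  by rewrite -!mulgA ss' mulg1 mulgA ss' mul1g.
- by exists c, s', s; split => //; rewrite qE mulgA ss' mul1g.
Qed.

(** If two reflections generate an infinite dihedral standard parabolic subgroup,
    then that subgroup contains two simple reflections [a] and [b].  A conjugate
    of [q] by the rotation [a * b] lies in the same coset of the group of [a] and
    [b], so that [q] and likewise [p] belong to it by [coset_refl_unique].  Then
    the rotations [p * q] and [a * b] are powers of each other. *)
Lemma infinite_pair_product p q J : refl p -> refl q -> J `<=` S ->
  (forall k, 0 < k -> (p * q) ^+ k <> 1) ->
  (forall x, span [set p; q] x <-> span J x) ->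
  exists a b, [/\ S a, S b & p * q = a * b].
Proof.
move=> rp rq JS inf pqJ.
have pp := refl_invol rp; have qq := refl_invol rq.
set u := p * q.
have infV k : 0 < k -> u ^- k <> 1.
  by move=> k0 e; apply: (inf k) => //; rewrite -/u -[u ^+ k]invgK e invg1.
have u2 : u <> u^-1.
  by move=> e; apply: (inf 2) => //; rewrite -/u expg2 {2}e mulgV.
have Jp : span J p by apply/pqJ/span_gen; left.
have Jq : span J q by apply/pqJ/span_gen; right.
have p1 : p <> 1 by apply/eqP/refl_neq1.
have [a Ja pa] := has_ldesc JS Jp p1.
have [b [Jb ba]] : exists b, J b /\ b <> a.
  apply: contrapT => none.
  have Ja1 x : span J x -> x = 1 \/ x = a.
    elim/span_ind => [|{}x y _ [->|->] Jy]; first by left.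
      by right; rewrite mul1g; apply: contrapT => ya; apply: none; exists y.
    left; have -> : y = a by apply: contrapT => ya; apply: none; exists y.
    exact: (gen_invol H (JS _ Ja)).
  have pE : p = a by case: (Ja1 _ Jp).
  have qE : q = a by case: (Ja1 _ Jq) => // q1; have /eqP := refl_neq1 rq.
  by apply: (inf 1%N) => //; rewrite expg1 pE qE (gen_invol H (JS _ Ja)).
have flip x : J x -> rotation u (x * p).
  move=> Jx; have Sx := JS _ Jx.
  have [[k xE]|//] := span_rotation pp qq ((pqJ x).2 (span_gen Jx)).
  have xx := gen_invol H Sx; have /eqP x1 := refl_neq1 (refl_gen Sx).
  case: k xE => [|k] xE; first by case: x1; case: xE => ->; rewrite ?invg1.
  exfalso; apply: (inf (k.+1 + k.+1)) => //; rewrite -/u expgnDr.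
  case: xE => xE; first by rewrite -xE.
  by rewrite -[u ^+ _]invgK -xE (invol_inv xx).
have fa := flip_invol pp qq (flip _ Ja); have fb := flip_invol pp qq (flip _ Jb).
rewrite -/u in fa fb.
have Sa := JS _ Ja; have Sb := JS _ Jb.
have aa := gen_invol H Sa; have bb := gen_invol H Sb.
have [v vdef] : exists v, v = a * b by exists (a * b).
have uv : u ^ v = u by rewrite vdef conjgM fa.2 conjVg fb.2 invgK.
have Jv : span [set p; q] v by rewrite vdef; apply/pqJ/spanM; apply: span_gen.
(* [v] commutes with the rotation [u], whereas reflections invert it. *)
have [k k0 vE] : exists2 k, 0 < k & v = u ^+ k \/ v = u ^- k.
  have [[k vE]|/(flip_invol pp qq)[_]] := span_rotation pp qq Jv; last first.
    by rewrite -/u uv => /u2.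
  case: k vE => [|k] vE; last by exists k.+1.
  case: ba; apply: (@mulgI _ a); rewrite -vdef aa.
  by case: vE => ->; rewrite ?expg0 ?invg1.
have rv : rotation u v by exists k.
have v2 : v * v <> 1.
  case: vE => ->; first by rewrite -expgnDr; apply: inf; rewrite addn_gt0 k0.
  by rewrite -invgM -expgnDr; apply: infV; rewrite addn_gt0 k0.
pose K := [set a; b]; have KS : K `<=` S := pair_sub Sa Sb.
have Kv : span K v by rewrite vdef; apply: spanM; apply: span_gen; [left|right].
have inK x : refl x -> v ^ x = v^-1 -> span K x.
  move=> rx vx; apply: contrapT => nKx; apply: v2.
  have xv : x = x ^ v.
    apply: (coset_refl_unique KS rx (reflJ v rx)) nKx.
    suff e : x * x ^ v = v * v by rewrite e; exact: (spanM Kv Kv).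
    rewrite [x ^ v]conjgE !mulgA; congr (_ * _).
    have e2 : (v^-1) ^ x = v by rewrite conjVg vx invgK.
    by rewrite -[RHS]e2 conjgE (reflV rx) mulgA.
  have := conjg_comm (esym xv) => com.
  by rewrite -{1}[v]invgK -vx conjgE com mulKg mulVg.
have [vp vq] := rotation_inv pp qq rv.
have Ku : span K u by apply: spanM; apply: inK.
have [[j uE]|/(flip_invol aa bb)[uu _]] := span_rotation aa bb Ku; last first.
  by case: (inf 2).
rewrite -vdef in uE.
have j1 : j = 1%N.
  have [jk|jk] : u = u ^+ (k * j) \/ u = u ^- (k * j).
  - case: vE => vE; case: uE => uE; rewrite vE ?expVgn -?expgnA ?invgK in uE.
    + by left.
    + by right.
    + by right.
    + by left.
  - case: j jk {uE} => [|j]; first by rewrite muln0 => u1; case: (inf 1%N).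
    case: j => // j jk; exfalso; apply: (inf (k * j.+2).-1).
      by case: k k0 {vE rv jk} => // k _; rewrite mulSn.
    apply: (@mulgI _ u); rewrite -/u -expgS mulg1 prednK ?muln_gt0 ?k0 //.
  exfalso; apply: (inf (k * j).+1) => //.
  by rewrite -/u expgS {1}jk mulVg.
case: uE => ->; rewrite j1 expg1; first by exists a, b.
by exists b, a; split=> //; rewrite vdef invgM !invol_inv.
Qed.

End CoxeterSystem.

Section DihedralChambers.
Variables (W : groupType) (S : set W) (sep : W -> W -> bool).
Hypothesis H : reflection_cocycle S sep.
Implicit Types (a b p q c t w x : W).

Lemma finite_inversions w : finite_set [set t | sep w t].
Proof.
elim/span_ind: w / (gen_span H w) => [|w s _ IHw Ss].
  by apply: (@finite_sub_seq _ _ [::]) => t /=; rewrite (sep1 H).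
apply: (@sub_finite_set _ _ ([set t | sep w t] `|` [set s ^ w^-1])).
  move=> t /=; rewrite (sepMs H) //; case: (sep w t); first by left.
  by rewrite conjg_eqV => /eqP; right.
by rewrite finite_setU; split => //; apply: finite_set1.
Qed.

Lemma len_coset I g x : I `<=` S -> (forall y, span I y -> ~~ sep x y) ->
  span I g -> len H (g * x) = (len H g + len H x)%N.
Proof.
move=> IS nx; move gn : (len H g) => n; elim: n g gn => [|n IHn] g gn Ig.
  by rewrite (len_eq0 gn) mul1g.
have g1 : g <> 1 by move=> g1; move: gn; rewrite g1 (len1 H).
have [a Ia ga] := has_ldesc H IS Ig g1.
have gxa : sep (g * x) a.
  rewrite (sepM H) ga; apply: nx.
  by apply: spanJ => //; [apply: (involS H)|apply: span_gen].
move: gn; rewrite (len_down H (IS _ Ia) gxa) (len_down H (IS _ Ia) ga) => -[gn].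
rewrite mulgA IHn //.
by apply: spanM => //; apply: span_gen.
Qed.

Lemma nsep_rotation a b k : S a -> S b ->
  (forall i, 0 < i -> (a * b) ^+ i <> 1) -> sep ((b * a) ^+ k) a = false.
Proof.
move=> Sa Sb inf; have aa := gen_invol H Sa; have bb := gen_invol H Sb.
have -> : (b * a) ^+ k = alt b a k.*2 by rewrite altE odd_double doubleK mulg1.
apply: (nsep_alt H) => // j _ aE; apply: (inf j.+1) => //.
rewrite (expg_inv _ bb aa) expgSr mulgA -aE aa; exact: invg1.
Qed.

(** The longest element of a finite dihedral subgroup leads to a chamber which
    has the same walls and lies on the other side of both. *)
Lemma opposite_chamber a b : S a -> S b ->
  (exists2 k, 0 < k & (a * b) ^+ k = 1) -> exists w,
  [/\ S (a ^ w), S (b ^ w), sep w a & sep w b].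
Proof.
move=> Sa Sb [k0 k0_gt0 k0P]; have aa := gen_invol H Sa; have bb := gen_invol H Sb.
have exm : exists k, (0 < k) && `[< (a * b) ^+ k = 1 >].
  by exists k0; rewrite k0_gt0; apply/asboolP.
case: (ex_minnP exm) => -[//|m] /andP[_ /asboolP mP] min_m.
have nrel i : 0 < i <= m -> (a * b) ^+ i <> 1.
  by move=> /andP[i0 im] e; have := min_m i; rewrite i0 ltnNge im (asboolT e) => /(_ isT).
have eqw : alt a b m.+1 = alt b a m.+1 by rewrite alt_expg // mP mul1g.
have top c d : S c -> S d -> (forall i, 0 < i <= m -> (c * d) ^+ i <> 1) ->
    sep (alt c d m.+1) c.
  move=> Sc Sd nr; have cc := gen_invol H Sc; have dd := gen_invol H Sd.
  rewrite [alt _ _ _]/= (sep_mul_refl H) ?(nsep_alt H) //; last exact: refl_gen.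
  move=> j jm cE; apply: (nr j.+1); rewrite ?jm //.
  rewrite (expg_inv _ dd cc) expgSr mulgA -cE cc; exact: invg1.
have nxtJ c d : S c -> S d -> alt c d m.+1 = alt d c m.+1 -> S (c ^ alt c d m.+1).
  move=> Sc Sd e; have := pair_sub Sc Sd (nxt_pair c d m.+1).
  suff -> : c ^ alt c d m.+1 = nxt c d m.+1 by [].
  apply: (@mulgI _ (alt c d m.+1)); rewrite -altS conjgE mulVKg.
  by rewrite {1}e.
exists (alt a b m.+1); split; [exact: nxtJ| |exact: top|].
  by rewrite eqw; apply: nxtJ.
rewrite eqw; apply: top => // i im.
rewrite (expg_inv _ aa bb) => /(congr1 (fun x => x^-1)); rewrite invgK invg1.
exact: nrel.
Qed.

End DihedralChambers.

Lemma span_pairJ (W : groupType) (p q d x : W) :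
  span [set p; q] x -> span [set p ^ d; q ^ d] (x ^ d).
Proof.
elim/span_ind=> [|w s _ IH e]; first by rewrite conj1g; apply: span1.
by rewrite conjMg; apply: spanMr => //; case: e => ->; [left|right].
Qed.

(** * Two Coxeter systems with the same parabolic subgroups of rank two *)

(** Walls and distances are measured in [R], sides in [S].  The hypotheses say
    that elements of [R] are [S]-reflections, that a pair in [R] generating an
    infinite dihedral group generates an [S]-parabolic subgroup, and that the
    other pairs have the angles of a pair in [S]. *)
Section TwoSystems.
Variables (W : groupType) (S R : set W) (sepS sepR : W -> W -> bool).
Hypotheses (HS : reflection_cocycle S sepS) (HR : reflection_cocycle R sepR).
Hypothesis R_fin : finite_set R.
Hypothesis R_refl : forall r, R r -> refl S r.
Hypothesis R_infinite : forall p q, R p -> R q ->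
  (forall k, 0 < k -> (p * q) ^+ k <> 1) -> exists J d,
  J `<=` S /\ forall x, span [set p; q] x <-> span J (x ^ d).
Hypothesis R_finite : forall p q, R p -> R q ->
  (exists2 k, 0 < k & (p * q) ^+ k = 1) -> exists d s s',
  [/\ S s, S s' & (p * q) ^ d = s * s'].
Implicit Types (a b c d g p q r s t w x y z : W).
Local Notation lenR := (len HR).

Let refl_RS t : refl R t -> refl S t.
Proof. by move=> [r [x [/R_refl Sr ->]]]; apply: reflJ. Qed.

(** The [S]-chamber [c] is adjacent to the walls of both [p] and [q]. *)
Definition walls p q c := S (p ^ c) /\ S (q ^ c).

Lemma exists_walls p q : R p -> R q -> p <> q -> exists c, walls p q c.
Proof.
move=> Rp Rq pq.
suff [d [s [s' [Ss Ss' e]]]] : exists d s s', [/\ S s, S s' & (p * q) ^ d = s * s'].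
  have [c [a [b [Sa Sb pa qb]]]] :=
    conj_pair HS (R_refl Rp) (R_refl Rq) pq Ss Ss' e.
  by exists c; split; rewrite ?pa ?qb.
have [fin|inf] := pselect (exists2 k, 0 < k & (p * q) ^+ k = 1).
  exact: R_finite.
have inf' k : 0 < k -> (p * q) ^+ k <> 1 by move=> k0 e; apply: inf; exists k.
have [J [d [JS Jd]]] := R_infinite Rp Rq inf'.
have [||k k0|x|a [b [Sa Sb e]]] :=
    @infinite_pair_product _ _ _ HS (p ^ d) (q ^ d) J _ _ JS.
- exact/reflJ/R_refl.
- exact/reflJ/R_refl.
- rewrite -conjMg -conjXg => /eqP; rewrite conjg_eq1 => /eqP; exact: inf'.
- split=> [Ix|Jx].
    have := span_pairJ d^-1 Ix; rewrite !conjgK => /Jd; by rewrite conjgKV.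
  have /Jd/(span_pairJ d) : span J ((x ^ d^-1) ^ d) by rewrite conjgKV.
  by rewrite conjgKV.
by exists d, a, b; rewrite conjMg.
Qed.

(** * Matching the half-spaces of the two systems *)

(** Beyond the distance [K] from a wall, its [S]-side is constant along
    [R]-galleries and does not change under right multiplication by the elements
    [d] relating the infinite rank two residues of the two systems. *)
Definition separation_bound K :=
  (forall r t, R r -> sepS r t -> lenR t < K) /\
  (forall p q, R p -> R q -> (forall k, 0 < k -> (p * q) ^+ k <> 1) ->
    exists J d, [/\ J `<=` S, forall x, span [set p; q] x <-> span J (x ^ d) &
    forall t, sepS d t -> lenR t < K]).

Lemma separation_boundP : exists K, separation_bound K.
Proof.
have : exists f : W -> W -> set W * W, forall p q, R p -> R q ->
    (forall k, 0 < k -> (p * q) ^+ k <> 1) ->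
    (f p q).1 `<=` S /\
    forall x, span [set p; q] x <-> span (f p q).1 (x ^ (f p q).2).
  suff /choice[g gP] : forall u : W * W, exists v : set W * W,
      R u.1 -> R u.2 -> (forall k, 0 < k -> (u.1 * u.2) ^+ k <> 1) ->
      v.1 `<=` S /\ forall x, span [set u.1; u.2] x <-> span v.1 (x ^ v.2).
    by exists (fun p q => g (p, q)) => p q; apply: (gP (p, q)).
  move=> [p q]; have [|no] := pselect [/\ R p, R q &
      forall k, 0 < k -> (p * q) ^+ k <> 1].
    by move=> [Rp Rq inf]; have [J [d Jd]] := R_infinite Rp Rq inf; exists (J, d).
  by exists (set0, 1) => Rp Rq inf; case: no.
move=> [f fP].
pose D := R `|` [set (f p q).2 | p in R & q in R].
have D_fin : finite_set D by rewrite finite_setU; split=> //; apply: finite_image2.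
pose F := \bigcup_(d in D) [set t | sepS d t].
have F_fin : finite_set F.
  by apply: bigcup_finite => // d _; apply: (finite_inversions HS).
have [K KP] := finite_bound lenR F_fin.
exists K; split=> [r t Rr rt|p q Rp Rq inf].
  by apply: KP; exists r => //; left.
have [JS Jd] := fP p q Rp Rq inf.
exists (f p q).1, (f p q).2; split => // t dt; apply: KP.
by exists (f p q).2 => //; right; exists p => //; exists q.
Qed.

Definition bound := xget 0 separation_bound.

(** Far from the wall of [t] the [S]-sides and the [R]-sides of [t] are matched, up
    to a global exchange.  By confluence it suffices that the [S]-side is
    constant along the moves allowed there.  For an infinite rank two
    [R]-residue [z * <a, b>], translation by [d] turns it into an [S]-residue,
    which lies on one [S]-side of [t] if [t] does not stabilize it. *)
Lemma matching t : refl R t -> exists e, forall z, bound <= lenR (t ^ z) ->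
  sepS z t = sepR z t (+) e.
Proof.
move=> rt; have rtS := refl_RS rt.
have [K1 K2] := xgetPex 0 separation_boundP; rewrite -/bound in K1 K2.
have [[y yK]|none] := pselect (exists y, bound <= lenR (t ^ y)); last first.
  by exists false => z zK; case: none; exists z.
pose A z := bound <= lenR (t ^ z) /\ sepS z t = sepS y t.
have A0 z : A z -> bound <= lenR (t ^ z) by case.
have A1 z s : R s -> A z -> bound <= lenR (t ^ (z * s)) -> A (z * s).
  move=> Rs [zK ez] zsK; split => //; rewrite -ez (sepM HS).
  case: (boolP (sepS s (t ^ z))) => [/(K1 _ _ Rs)|]; last by rewrite addbF.
  by rewrite ltnNge zK.
have A2 z a b w : R a -> R b -> A z ->
    (forall k, 0 < k -> (a * b) ^+ k <> 1) -> ~ span [set a; b] (t ^ z) ->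
    span [set a; b] w -> bound <= lenR (t ^ (z * w)) -> A (z * w).
  move=> Ra Rb [zK ez] inf nz Iw zwK; split => //; rewrite -ez.
  have [J [d [JS Jd dK]]] := K2 _ _ Ra Rb inf.
  have shift x : bound <= lenR (t ^ x) -> sepS (x * d) t = sepS x t.
    rewrite (sepM HS); case: (boolP (sepS d (t ^ x))) => [/dK|]; last by rewrite addbF.
    by rewrite ltnNge => /negbTE ->.
  rewrite -shift // -(shift z) //.
  have -> : z * w * d = z * d * w ^ d by rewrite conjgE !mulgA mulgK.
  rewrite (sepM HS (z * d)).
  suff -> : sepS (w ^ d) (t ^ (z * d)) = false by rewrite addbF.
  by apply: (nsep_span HS JS); [exact/Jd|rewrite conjgM => /Jd].
(* Chambers across the wall of [t] are reflected back by [t]. *)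
exists (sepR y t (+) sepS y t) => z zK.
have Ay : reaches HR t A y by apply: reaches_A.
have side x : bound <= lenR (t ^ x) -> sepR x t = sepR y t ->
    sepS x t = sepR x t (+) (sepR y t (+) sepS y t).
  move=> xK /[dup] e ->; rewrite addbA addbb addFb.
  have rx := reaches_half_space rt A0 A1 A2 (esym e) Ay.
  by have [] := reaches_high A1 xK rx.
have [e|ne] := eqVneq (sepR z t) (sepR y t); first exact: side.
have := side (t * z); rewrite (sep_mul_refl HR) // (sep_mul_refl HS) //.
rewrite conjgM [t ^ t]conjgE mulKg => /(_ zK).
move: ne; case: (sepR z t); case: (sepR y t) => // _ /(_ erefl);
  by case: (sepS z t); case: (sepS y t).
Qed.

(** * Signs for all pairs of generators *)

Lemma finite_order_conj p q c : (exists2 k, 0 < k & (p * q) ^+ k = 1) ->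
  exists2 k, 0 < k & (p ^ c * q ^ c) ^+ k = 1.
Proof. by move=> [k k0 e]; exists k; rewrite // -conjMg -conjXg e conj1g. Qed.

(** A sign [e r] selects an [S]-half-space bounded by the wall of [r], for [r] in
    [R]: the chambers that are not [outside]. *)
Section Signs.
Variable e : W -> bool.

Definition outside r x := sepS x r (+) e r.

Lemma outsideM r c z : outside r (c * z) = outside r c (+) sepS z (r ^ c).
Proof. by rewrite /outside (sepM HS) -!addbA; congr (_ (+) _); rewrite addbC. Qed.

Lemma outside_refl r x : R r -> outside r (r * x) = ~~ outside r x.
Proof. by move=> /R_refl rr; rewrite /outside (sep_mul_refl HS) // addNb. Qed.

(** The selected half-spaces of [p] and [q] meet in a fundamental domain of the
    group generated by [p] and [q]. *)
Definition geometric p q :=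
  exists c, [/\ walls p q c, outside p c = false & outside q c = false].

Lemma geometric_or_opposite p q c : (exists2 k, 0 < k & (p * q) ^+ k = 1) ->
  walls p q c -> outside p c = outside q c -> geometric p q.
Proof.
move=> /(finite_order_conj c) fin [Sp Sq] pq.
have [o|/negbTE o] := boolP (outside p c); last by exists c; split; rewrite // -pq.
have [w [Spw Sqw wp wq]] := opposite_chamber HS Sp Sq fin.
exists (c * w); rewrite /walls !conjgM; split=> //; rewrite outsideM.
  by rewrite o wp.
by rewrite -pq o wq.
Qed.

(** At a right angle all four choices of signs are good. *)
Lemma geometric_commute p q : R p -> R q -> p <> q -> p ^ q = p -> geometric p q.
Proof.
move=> Rp Rq pq com; have [c [Sp Sq]] := exists_walls Rp Rq pq.
have pqc : p ^ c == q ^ c = false by apply/eqP => /conjg_inj.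
have qpc : q ^ c == p ^ c = false by rewrite eq_sym.
have cJ z : z ^ z = z by rewrite conjgE mulKg.
have com1 : (p ^ c) ^ (q ^ c) = p ^ c by rewrite -conjJg com.
have com2 := conjg_comm_sym com1.
suff [z [zp zq sp sq]] : exists z, [/\ (p ^ c) ^ z = p ^ c, (q ^ c) ^ z = q ^ c,
    sepS z (p ^ c) = outside p c & sepS z (q ^ c) = outside q c].
  exists (c * z); rewrite /walls !conjgM zp zq; split => //; rewrite outsideM.
    by rewrite sp addbb.
  by rewrite sq addbb.
move: (outside p c) (outside q c) Sp Sq pqc qpc com1 com2.
move: (p ^ c) (q ^ c) => a b op oq Sa Sb ab ba com1 com2.
case: op; case: oq.
- exists (a * b); rewrite !conjgM !(sepM HS) !cJ com1 com2 !cJ.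
  by rewrite !(sep_gen HS) // !eqxx ab ba.
- by exists a; rewrite cJ com2 !(sep_gen HS) // eqxx ba.
- by exists b; rewrite cJ com1 !(sep_gen HS) // eqxx ab.
- by exists 1; rewrite !conjg1 !(sep1 HS).
Qed.

(** The selected half-space is the one that matches the [R]-half-space of [1]. *)
Definition matched r := forall z, bound <= lenR (r ^ z) ->
  outside r z = sepR z r.

Lemma infinite_rotation_inj p q : R p -> R q ->
  (forall k, 0 < k -> (p * q) ^+ k <> 1) ->
  injective (fun k => p ^ ((q * p) ^+ k)).
Proof.
move=> Rp Rq inf.
have pp := gen_invol HR Rp; have qq := gen_invol HR Rq.
have pE k : p ^ ((q * p) ^+ k) = (p * q) ^+ k.*2 * p.
  rewrite conjgE (expg_inv _ pp qq) invgK -(expg_inv k pp qq) -addnn expgnDr.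
  by rewrite -mulgA -expg_swap mulgA.
have le m n : m <= n -> (p * q) ^+ m.*2 = (p * q) ^+ n.*2 -> m = n.
  move=> mn em; apply/eqP; rewrite eqn_leq mn /= leqNgt; apply/negP => lt.
  apply: (inf (n.*2 - m.*2)); first by rewrite subn_gt0 ltn_double.
  by rewrite expgnFr ?leq_double // em mulgV.
move=> m n; rewrite /= !pE => /mulIg em.
by have [/le->//|/ltnW/le<-//] := leqP m n.
Qed.

(** Apply the rotations of the infinite dihedral group to [c]: the chambers
    obtained are arbitrarily far from the wall of [p], on the [R]-side of [1],
    and on the [S]-side of [c]. *)
Lemma infinite_matched p q c : R p -> R q ->
  (forall k, 0 < k -> (p * q) ^+ k <> 1) -> walls p q c -> matched p ->
  outside p c = false.
Proof.
move=> Rp Rq inf [Sp Sq] mp.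
have f_inj := infinite_rotation_inj Rp Rq inf.
(* The rotations to be avoided: too close to the wall, or blurred by [c]. *)
pose Bad := [set w ^ c^-1 | w in [set w | lenR w < bound]] `|` [set t | sepR c t].
have [k nbad] : exists k, ~ Bad (p ^ ((q * p) ^+ k)).
  apply: contrapT => bad; apply: (inj_not_finite f_inj (F := Bad)).
    by move=> k; apply: contrapT => nb; apply: bad; exists k.
  rewrite finite_setU; split; last exact: (finite_inversions HR).
  by apply: finite_image; apply: finite_ball.
set g := (q * p) ^+ k in nbad.
have deep : bound <= lenR (p ^ (g * c)).
  rewrite leqNgt; apply/negP => lt; apply: nbad; left; exists (p ^ (g * c)) => //.
  by rewrite conjgM conjgK.
have := mp _ deep; rewrite (sepM HR) (nsep_rotation HR) //.
have -> : sepR c (p ^ g) = false by apply/negP => sc; apply: nbad; right.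
have -> : g * c = c * (q ^ c * p ^ c) ^+ k by rewrite -conjMg -conjXg conjgE mulVKg.
rewrite outsideM (nsep_rotation HS) // ?addbF // => i i0.
rewrite -conjMg -conjXg => /eqP; rewrite conjg_eq1 => /eqP; exact: inf.
Qed.

Lemma geometric_infinite p q : R p -> R q -> p <> q ->
  (forall k, 0 < k -> (p * q) ^+ k <> 1) -> matched p -> matched q ->
  geometric p q.
Proof.
move=> Rp Rq pq inf mp mq; have [c [Sp Sq]] := exists_walls Rp Rq pq.
have pp := gen_invol HR Rp; have qq := gen_invol HR Rq.
exists c; split => //; first exact: (infinite_matched Rp Rq inf).
apply: (infinite_matched Rq Rp) => // k k0; rewrite (expg_inv _ pp qq) => e1.
by apply: (inf k) => //; rewrite -[LHS]invgK e1 invg1.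
Qed.

Lemma finite_pair_span p q : R p -> R q ->
  (exists2 k, 0 < k & (p * q) ^+ k = 1) -> finite_set (span [set p; q]).
Proof.
move=> Rp Rq [m m0 um].
have pp := gen_invol HR Rp; have qq := gen_invol HR Rq.
pose Rot := [set (p * q) ^+ k | k in [set k | k < m]] `|`
  [set (p * q) ^- k | k in [set k | k < m]].
have Rot_fin : finite_set Rot.
  by rewrite finite_setU; split; apply: finite_image; apply: finite_II.
have rotP x : rotation (p * q) x -> Rot x.
  have modE k : (p * q) ^+ k = (p * q) ^+ (k %% m).
    by rewrite {1}(divn_eq k m) mulnC expgnDr expgnA um expg1n mul1g.
  by move=> [k [->|->]]; rewrite modE; [left|right]; exists (k %% m); rewrite //= ltn_mod.
apply: (@sub_finite_set _ _ (Rot `|` [set x * p | x in Rot])).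
  move=> x /(span_rotation pp qq) [/rotP|/rotP r]; first by left.
  by right; exists (x * p); rewrite // -mulgA pp mulg1.
by rewrite finite_setU; split=> //; apply: finite_image.
Qed.

(** Take a chamber far from all the walls of the finite dihedral group, on the
    [R]-side of [1] for each of them.  If [c] were selected by [p] only, then the
    matching, applied to that chamber and to its images under [p] and [q], would
    place it in an [S]-sector that exists only when [p] and [q] commute. *)
Lemma matched_agree p q c : R p -> R q -> p ^ q <> p ->
  (exists2 k, 0 < k & (p * q) ^+ k = 1) ->
  ~ finite_set (conj_class p) -> ~ finite_set (conj_class q) ->
  matched p -> matched q -> walls p q c ->
  outside p c = false -> outside q c = false.
Proof.
move=> Rp Rq ncom fin infp infq mp mq [Sp Sq] op.
apply/negP => oq; pose I := [set p; q].
have IR : I `<=` R := pair_sub Rp Rq.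
have Ip : span I p by apply: span_gen; left.
have Iq : span I q by apply: span_gen; right.
have [E EI] := (finite_seqP (span I)).1 (finite_pair_span Rp Rq fin).
have mem_E g : (g \in E) <-> span I g by rewrite EI.
have [x xP] : exists x, forall g, span I g ->
    bound <= lenR (p ^ (g * x)) /\ bound <= lenR (q ^ (g * x)).
  have [t|x xP] := @deep_chamber _ _ _ HR R_fin
    ([seq p ^ g | g <- E] ++ [seq q ^ g | g <- E]) bound.
    rewrite mem_cat => /orP[] /mapP[g _ ->].
      apply: contra_not infp; apply: sub_finite_set => _ [y _ <-].
      by exists (g^-1 * y) => //; rewrite conjgM conjgK.
    apply: contra_not infq; apply: sub_finite_set => _ [y _ <-].
    by exists (g^-1 * y) => //; rewrite conjgM conjgK.
  exists x => g /mem_E gE; rewrite !conjgM; split; apply: xP; rewrite mem_cat map_f //.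
  by rewrite orbT.
(* The walls of the dihedral group are permuted by [g], so [g * x] is still far. *)
have [g Ig gP] := coset_min HR I x.
have inf_p z : span I z -> outside p (z * (g * x)) = sepR z p.
  move=> Iz; rewrite mp; last by rewrite mulgA; apply: (xP _ _).1; apply: spanM.
  rewrite (sepM HR) (negPf (gP _ _)) ?addbF //.
  by apply: spanJ => //; apply: (involS HR).
have inf_q z : span I z -> outside q (z * (g * x)) = sepR z q.
  move=> Iz; rewrite mq; last by rewrite mulgA; apply: (xP _ _).2; apply: spanM.
  rewrite (sepM HR) (negPf (gP _ _)) ?addbF //.
  by apply: spanJ => //; apply: (involS HR).
have pq : p == q = false by apply/eqP => pq; apply: ncom; rewrite pq conjgE mulKg.
have qp : q == p = false by rewrite eq_sym.
set v := g * x in inf_p inf_q; pose y := c^-1 * v.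
set a := p ^ c in Sp; set b := q ^ c in Sq.
have vE : v = c * y by rewrite mulVKg.
have pE z : p * (c * z) = c * (a * z) by rewrite /a conjgE -!mulgA mulVKg.
have qE z : q * (c * z) = c * (b * z) by rewrite /b conjgE -!mulgA mulVKg.
have sa : sepS y a = false.
  by have := inf_p 1 (span1 _); rewrite mul1g (sep1 HR) vE outsideM op.
have sb : sepS y b = true.
  by have := inf_q 1 (span1 _); rewrite mul1g (sep1 HR) vE outsideM oq => /negbFE.
have ba : b == a = false by apply/eqP => /conjg_inj/eqP; rewrite qp.
have ab : a == b = false by rewrite eq_sym.
have sab : sepS y (b ^ a) = true.
  have := inf_q p Ip; rewrite (sep_gen HR) // qp vE pE outsideM oq (sepM HS).
  by rewrite (sep_gen HS) // ba => /negbFE.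
have sba : sepS y (a ^ b) = false.
  have := inf_p q Iq; rewrite (sep_gen HR) // pq vE qE outsideM op (sepM HS).
  by rewrite (sep_gen HS) // ab.
have KS := pair_sub Sp Sq.
have nby : forall z, span [set a; b] z -> ~~ sepS (b * y) z.
  apply: (nsep_coset HS KS) => _ [->|->].
    by rewrite (sepM HS) sba (sep_gen HS) // ab.
  by rewrite (sep_mul_refl HS) ?sb //; apply: refl_gen.
have yE : y = b * (b * y) by rewrite mulgA (gen_invol HS Sq) mul1g.
have := sepM HS b (b * y) (b ^ a); rewrite -yE sab (sep_gen HS) //.
have /negPf -> : ~~ sepS (b * y) ((b ^ a) ^ b).
  by apply: nby; apply: spanJ; [exact: (involS HS)|apply: spanJ; [exact: (involS HS)| |]|];
     apply: span_gen; [right|left|right].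
rewrite addbF => /esym/eqP e1; apply: ncom; apply: conjg_comm_sym.
by apply: (@conjg_inj _ c); rewrite conjJg.
Qed.

Lemma geometric_matched p q : R p -> R q -> p <> q ->
  ~ finite_set (conj_class p) -> ~ finite_set (conj_class q) ->
  matched p -> matched q -> geometric p q.
Proof.
move=> Rp Rq pq infp infq mp mq.
have [fin|inf] := pselect (exists2 k, 0 < k & (p * q) ^+ k = 1); last first.
  by apply: geometric_infinite => // k k0 e1; apply: inf; exists k.
have [com|ncom] := eqVneq (p ^ q) p; first exact: geometric_commute.
have [c wc] := exists_walls Rp Rq pq.
apply: (geometric_or_opposite fin wc).
have agree := @matched_agree _ _ c Rp Rq _ fin infp infq mp mq wc.
have fin' : exists2 k, 0 < k & (q * p) ^+ k = 1.
  case: fin => k k0 e1; exists k => //.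
  by rewrite (expg_inv _ (gen_invol HR Rp) (gen_invol HR Rq)) e1 invg1.
have wc' : walls q p c by case: wc.
have agree' := @matched_agree _ _ c Rq Rp _ fin' infq infp mq mp wc'.
case op : (outside p c); case oq : (outside q c) => //.
  by rewrite agree' // in op => /conjg_comm_sym; apply/eqP.
by rewrite agree // in oq; apply/eqP.
Qed.

End Signs.

Let finite_type r := finite_set (conj_class r).

Lemma finite_type_neighbour p q : R p -> R q -> finite_type p -> p ^ q <> p ->
  finite_type q.
Proof.
move=> Rp Rq fp ncom.
have [X [XR Xp Xcom Xfin]] := finite_class_factor HR Rp fp.
have Xq : X q by apply: contrapT => /(Xcom _ _ Xp Rq).
exact: (factor_class HR XR Xq).
Qed.

(** The part of the diagram formed by generators with finitely many conjugates is
    a forest: otherwise it carries an infinite walk without backtracking inside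
    a finite factor. *)
Lemma exists_leaf (L : seq W) r0 : r0 \in L ->
  (forall r, r \in L -> R r /\ finite_type r) ->
  exists2 r, r \in L & forall q q', q \in L -> q' \in L ->
    r ^ q <> r -> r ^ q' <> r -> q = q'.
Proof.
move=> r0L LP; apply: contrapT => no_leaf.
have branch u : exists v, u.2 \in L -> [/\ v \in L, u.2 ^ v <> u.2 & v <> u.1].
  have [uL|uL] := boolP (u.2 \in L); last by exists 1.
  apply: contrapT => none; apply: no_leaf; exists u.2 => // q q' qL qL' nq nq'.
  have nb v : v \in L -> u.2 ^ v <> u.2 -> v = u.1.
    by move=> vL nv; apply: contrapT => vu; apply: none; exists v.
  by rewrite (nb q) // (nb q').
have [nx nxP] := choice branch.
pose step (u : W * W) := (u.2, nx u).
pose c n := (iter n step (r0, r0)).2.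
have cL n : c n \in L.
  by elim: n => [//|n IHn]; have [] := nxP _ IHn.
have cR n : R (c n) by have [] := LP _ (cL n).
have c_step n : c n ^ c n.+1 <> c n by have [] := nxP _ (cL n).
have c_nback n : c n.+2 <> c n by have [] := nxP _ (cL n.+1).
have [X [XR X0 Xcom Xfin]] := finite_class_factor HR (cR 0) (LP _ (cL 0)).2.
apply: (walk_infinite HR cR c_step c_nback XR _ Xfin).
elim=> [//|n IHn]; apply: contrapT => nX.
exact: (c_step n (Xcom _ _ IHn (cR _) nX)).
Qed.

(** On a forest the signs can be chosen one leaf at a time. *)
Lemma forest_signs (L : seq W) :
  (forall r, r \in L -> R r /\ finite_type r) ->
  exists e, forall p q, p \in L -> q \in L -> p ^ q <> p ->
    exists2 c, walls p q c & outside e p c = outside e q c.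
Proof.
have [n] := ubnP (size L); elim: n L => // n IHn L; rewrite ltnS => Ln LP.
case: L Ln LP => [|r0 L0] Ln LP; first by exists xpred0.
set L := r0 :: L0 in Ln LP *; have r0L : r0 \in L by apply: mem_head.
have [r rL leaf] := exists_leaf r0L LP.
have [||e' e'P] := IHn (filter (predC1 r) L).
- apply: leq_trans Ln; rewrite size_filter -(count_predC (pred1 r) L).
  by rewrite -[ltnLHS]add0n ltn_add2r -has_count has_pred1.
- by move=> x; rewrite mem_filter => /andP[_ /LP].
have [beta betaP] : exists beta : bool, forall q, q \in L -> r ^ q <> r ->
    exists2 c, walls r q c & sepS c r (+) beta = outside e' q c.
  have [[q [qL nq]]|none] := pselect (exists q, q \in L /\ r ^ q <> r); last first.
    by exists false => q qL nq; case: none; exists q.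
  have rq : r <> q by move=> rq; apply: nq; rewrite rq conjgE mulKg.
  have [c wc] := exists_walls (LP _ rL).1 (LP _ qL).1 rq.
  exists (sepS c r (+) outside e' q c) => q' q'L nq'.
  by exists c; rewrite -(leaf q q') // addbA addbb addFb.
exists (fun x => if x == r then beta else e' x) => p q pL qL npq.
have pq : p <> q by move=> pq; apply: npq; rewrite pq conjgE mulKg.
rewrite /outside; have [pr|pr] := eqVneq p r; have [qr|qr] := eqVneq q r.
- by case: pq; rewrite pr qr.
- by rewrite pr in npq *; apply: betaP.
- have [|c [wq wp] ec] := betaP p pL.
    by rewrite -qr => /conjg_comm_sym.
  by exists c; rewrite ?qr // ec.
- by apply: e'P; rewrite // mem_filter /= ?pr ?qr.
Qed.

(** Matching fixes the signs of the generators with infinitely many conjugates;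
    the others commute with these and receive their signs from the forest. *)
Lemma exists_signs : exists e,
  (forall r, R r -> ~ finite_type r -> matched e r) /\
  (forall p q, R p -> R q -> p <> q -> geometric e p q).
Proof.
have [e0 e0P] : exists e0, forall r, R r -> matched e0 r.
  have /choice[f fP] : forall r, exists b : bool, R r -> forall z,
      bound <= lenR (r ^ z) -> sepS z r = sepR z r (+) b.
    move=> r; have [Rr|nRr] := pselect (R r); last by exists false.
    by have [b bP] := matching (refl_gen Rr); exists b.
  by exists f => r Rr z zK; rewrite /outside (fP r) // -addbA addbb addbF.
have [L LE] : exists L : seq W, forall r, r \in L <-> R r /\ finite_type r.
  have [L LE] := (finite_seqP (R `&` finite_type)).1 (finite_setIl _ R_fin).
  by exists L => r; change ([set` L] r <-> (R `&` finite_type) r); rewrite LE.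
have [|e1 e1P] := @forest_signs L; first by move=> r /LE.
pose e r := if `[< finite_type r >] then e1 r else e0 r.
have out_inf r x : ~ finite_type r -> outside e r x = outside e0 r x.
  by move=> nf; rewrite /outside /e asboolF.
have out_fin r x : finite_type r -> outside e r x = outside e1 r x.
  by move=> nf; rewrite /outside /e asboolT.
have mat r : R r -> ~ finite_type r -> matched e r.
  by move=> Rr nf z zK; rewrite out_inf //; apply: e0P.
exists e; split => // p q Rp Rq pq.
have [com|/eqP ncom] := eqVneq (p ^ q) p; first exact: geometric_commute.
have [fp|nfp] := pselect (finite_type p); last first.
  have nfq : ~ finite_type q.
    move=> fq; apply/nfp/(finite_type_neighbour Rq Rp fq).
    by move=> /conjg_comm_sym.
  by apply: geometric_matched => //; apply: mat.
have fq := finite_type_neighbour Rp Rq fp ncom.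
have [||c wc ec] := e1P p q _ _ ncom; [exact/LE|exact/LE|].
apply: (@geometric_or_opposite _ _ _ c) => //; last by rewrite !out_fin.
apply: contrapT => inf.
apply: (inj_not_finite (infinite_rotation_inj Rp Rq _) _ fp).
  by move=> k k0 e2; apply: inf; exists k.
by move=> k; apply: conj_classJ.
Qed.

(** * The common fundamental domain *)

(** Inside the dihedral group of [p] and [q] the two systems agree after moving
    to the chamber [c]. *)
Lemma dihedral_sep p q c g t : R p -> R q -> walls p q c ->
  span [set p; q] g -> sepR g t = sepS (g ^ c) (t ^ c).
Proof.
move=> Rp Rq [Sp Sq]; elim/span_ind: g / => [|g y _ IHg Iy].
  by rewrite conj1g (sep1 HR) (sep1 HS).
have [Ry Sy] : R y /\ S (y ^ c) by case: Iy => ->.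
rewrite conjMg (sepMs HR) // (sepMs HS) // IHg; congr (_ (+) _).
by rewrite -conjJg; apply/eqP/eqP => [->|/conjg_inj].
Qed.

Section Domain.
Variable e : W -> bool.
Hypothesis e_geometric : forall p q, R p -> R q -> p <> q -> geometric e p q.

Lemma dihedral_domain p q x g : R p -> R q -> p <> q ->
  outside e p x = false -> outside e q x = false -> span [set p; q] g ->
  sepR g p = false -> outside e p (g * x) = false.
Proof.
move=> Rp Rq pq px qx Ig gp.
have [c [wc pc qc]] := e_geometric Rp Rq pq; have [Sp Sq] := wc.
pose y := c^-1 * x; have xE : x = c * y by rewrite mulVKg.
have ny z : span [set p ^ c; q ^ c] z -> ~~ sepS y z.
  apply: (nsep_coset HS (pair_sub Sp Sq)) => _ [->|->].
    by move: px; rewrite xE outsideM pc => /negbT.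
  by move: qx; rewrite xE outsideM qc => /negbT.
have -> : g * x = c * (g ^ c * y) by rewrite conjgE !mulgA mulgV mul1g mulgK.
rewrite outsideM pc (sepM HS) -(dihedral_sep _ Rp Rq wc Ig) gp /=.
apply/negbTE/ny; apply: spanJ; first exact: (involS HS (pair_sub Sp Sq)).
  by apply: span_gen; left.
exact: span_pairJ.
Qed.

(** Tits's argument: the intersection of the selected half-spaces is moved by [w]
    to the side of [q] prescribed by [R]-lengths.  Split off from [w] its part in
    the dihedral group of [q] and of a descent of [w], where the claim is
    [dihedral_domain]. *)
Lemma domain_translates x : (forall r, R r -> outside e r x = false) ->
  forall w q, R q -> sepR w q = false -> outside e q (w * x) = false.
Proof.
move=> xP w; have [n] := ubnP (lenR w); elim: n w => // n IHn w.
rewrite ltnS => wn q Rq wq.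
have [->|/eqP w1] := eqVneq w 1; first by rewrite mul1g xP.
have [p Rp wp] := has_ldesc HR (@subset_refl _ R) (gen_span HR w) w1.
have pq : p <> q by move=> pq; rewrite pq wq in wp.
have IR := pair_sub Rp Rq; have iI := involS HR IR.
have [g Ig gP] := coset_min HR [set p; q] w.
set v := g * w in gP; have wE : w = g^-1 * v by rewrite mulKg.
have Ip : span [set p; q] p by apply: span_gen; left.
have Iq : span [set p; q] q by apply: span_gen; right.
have IgV := spanV iI Ig.
have vw : lenR v < lenR w.
  rewrite [in ltnRHS]wE (len_coset HR IR gP IgV) -[ltnLHS]add0n ltn_add2r lt0n.
  apply/eqP => /len_eq0 g1; move: wp; rewrite wE g1 mul1g; exact/negP/gP.
have vn : lenR v < n by apply: leq_trans wn.
rewrite wE -mulgA; apply: (dihedral_domain Rq Rp) => //.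
- exact/nesym.
- by apply: IHn => //; apply/negbTE/gP.
- by apply: IHn => //; apply/negbTE/gP.
- by rewrite setUC.
- move: wq; rewrite [in sepR w _]wE (sepM HR) (negPf (gP _ _)) ?addbF //.
  exact: spanJ.
Qed.

(** The selected half-spaces extend to a well defined choice for all the
    [R]-reflections: if [w] maps the [R]-half-space of [q] to that of [r], then
    it maps the selected half-spaces to each other.  As for Tits's argument, this
    reduces to dihedral groups. *)
Lemma sign_transport w r q : R r -> R q -> r ^ w = q -> sepR w r = false ->
  sepS w r = e r (+) e q.
Proof.
have [n] := ubnP (lenR w); elim: n w r q => // n IHn w r q.
rewrite ltnS => wn Rr Rq rw wr.
have [w1|/eqP w1] := eqVneq w 1.
  by rewrite -rw w1 conjg1 addbb (sep1 HS).
have wV1 : w^-1 <> 1 by move=> /eqP; rewrite invg_eq1 => /eqP.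
have [p Rp wp] := has_ldesc HR (@subset_refl _ R) (gen_span HR _) wV1.
have pq : p <> q.
  by move=> pq; move: wp; rewrite (sepV HR) pq -rw conjgK wr.
have IR := pair_sub Rp Rq; have iI := involS HR IR.
have [g Ig gP] := coset_min HR [set p; q] w^-1.
set v := g * w^-1 in gP; have wE : w = v^-1 * g by rewrite /v invgM invgK mulgVK.
have IgV := spanV iI Ig.
have Iq : span [set p; q] q by apply: span_gen; right.
pose t := r ^ v^-1.
have It : span [set p; q] t.
  by rewrite /t /v invgM invgK conjgM rw; apply: spanJ.
have tE : t * v = v * r by apply: conjgVM.
have rt : refl R t by apply/reflJ/refl_gen.
have t1 : t <> 1 by apply/eqP/(refl_neq1 HR).
have [a Ia ta] := has_ldesc HR IR It t1.
have Ra := IR _ Ia.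
have rV := reflV HR (refl_gen Rr).
(* [t * v = v * r] is one step longer than [v]. *)
have lt : lenR t <= 1.
  have := lenMs_le HR v^-1 Rr; rewrite (lenV HR) -(lenV HR (r * _)) invgM invgK rV.
  by rewrite -tE (len_coset HR IR gP It) -add1n leq_add2r.
have ta_eq : t = a.
  have : lenR (a * t) = 0.
    by move: lt; rewrite (len_down HR Ra ta) ltnS leqn0 => /eqP.
  by move=> /len_eq0 /mulg1_eq; rewrite (reflV HR (refl_gen Ra)).
have Rt : R t by rewrite ta_eq.
have pqt : [set p; q] t by rewrite ta_eq.
have vr : sepR v^-1 r = false by rewrite (sepV HR); apply/negbTE/gP.
have tg : t ^ g = q by rewrite /t -conjgM -wE.
have gt : sepR g t = false.
  by move: wr; rewrite [in sepR w _]wE (sepM HR) vr addFb.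
have lv : lenR v^-1 < n.
  apply: leq_trans wn; rewrite (lenV HR) -(lenV HR w).
  have -> : w^-1 = g^-1 * v by rewrite mulKg.
  rewrite (len_coset HR IR gP IgV) -[ltnLHS]add0n ltn_add2r lt0n.
  apply/eqP => /len_eq0 g1; move: wp.
  have -> : w^-1 = v by rewrite -[LHS](mulKg g) g1 mul1g.
  by apply/negP/gP/span_gen; left.
rewrite [in sepS w _]wE (sepM HS) (IHn _ _ _ lv Rr Rt erefl vr) -/t.
suff -> : sepS g t = e t (+) e q by rewrite addbA addbK.
have [c [_ pc qc]] := e_geometric Rp Rq pq.
have : outside e t (g * c) = false.
  case: pqt => tpq; rewrite tpq in gt *; first exact: (dihedral_domain Rp Rq).
  by apply: (dihedral_domain Rq Rp) => //; [exact/nesym|rewrite setUC].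
move: qc; rewrite /outside (sepM HS) tg.
by case: (sepS g t); case: (sepS c q); case: (e t); case: (e q).
Qed.

(** The wall of [t] is mismatched at [x] if [x] lies outside the half-space that
    the choice attaches to [t]. *)
Definition mismatch x t := exists w q,
  [/\ R q, sepR w q = false, outside e q (w * x) & t = q ^ w].

(** Crossing the wall of [r] permutes the remaining walls, so that it corrects the
    mismatch of [r] and creates none. *)
Lemma mismatch_decrease x r t : R r -> outside e r x -> mismatch (r * x) t ->
  mismatch x (t ^ r) /\ t <> r.
Proof.
move=> Rr rx [w [q [Rq wq wx tE]]].
have tr : t <> r.
  move=> tr; have qwr : q ^ w = r by rewrite -tE.
  have s := sign_transport Rq Rr qwr wq.
  move: wx; rewrite /outside (sepM HS) qwr s.
  have := outside_refl e x Rr; rewrite rx /outside.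
  by case: (sepS (r * x) r); case: (e r); case: (e q).
split=> //; exists (w * r), q; split => //; last by rewrite conjgM tE.
  by rewrite (sepMs HR) // wq -tE; apply/negbTE/eqP.
by rewrite -mulgA.
Qed.

Lemma exists_domain x0 : finite_set (mismatch x0) ->
  exists x, forall r, R r -> outside e r x = false.
Proof.
move=> /finite_seqP[L LE].
have : forall t, mismatch x0 t -> t \in L by move=> t; rewrite LE.
have [n] := ubnP (size L); elim: n x0 L {LE} => // n IHn x L; rewrite ltnS => Ln xL.
have [[r [Rr rx]]|none] := pselect (exists r, R r /\ outside e r x); last first.
  by exists x => r Rr; apply/negbTE/negP => rx; apply: none; exists r.
have rL : r \in L.
  by apply: xL; exists 1, r; rewrite (sep1 HR) mul1g conjg1.
apply: (IHn (r * x) [seq t ^ r | t <- L & t != r]).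
  rewrite size_map (leq_trans _ Ln) // size_filter -(count_predC (pred1 r) L).
  by rewrite -[ltnLHS]add0n ltn_add2r -has_count has_pred1.
move=> t /(mismatch_decrease Rr rx)[/xL tL tr].
have trr : (t ^ r) ^ r = t by rewrite -conjgM (gen_invol HR Rr) conjg1.
apply/mapP; exists (t ^ r) => //; rewrite mem_filter tL andbT.
apply/eqP => e1; apply: tr; rewrite -trr e1; by rewrite conjgE mulKg.
Qed.

End Domain.

(** At the chamber [1] only finitely many walls are mismatched, namely those near
    [1] and those of finite classes, so that some chamber [c] lies in all the
    selected half-spaces.  A wall of [c] separates [c] from the adjacent chamber,
    which by Tits's argument some [q] in [R] also does: so the walls of [c] belong
    to [R].  They generate the group, hence they exhaust [R]. *)
Theorem conjugate_systems : exists c, forall r, R r <-> S (r ^ c).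
Proof.
have [e [e_matched e_geo]] := exists_signs.
have [|c cP] := @exists_domain e e_geo 1.
  apply: (@sub_finite_set _ _ ([set t | lenR t < bound] `|`
    \bigcup_(q in R `&` [set q | finite_type q]) conj_class q)).
    move=> t [w [q [Rq wq wx ->]]].
    have [fq|nfq] := pselect (finite_type q).
      by right; exists q => //; apply: conj_classJ.
    left; rewrite /= ltnNge; apply/negP => deep.
    by move: wx; rewrite mulg1 (e_matched _ Rq nfq _ deep) wq.
  rewrite finite_setU; split; first exact: finite_ball.
  by apply: bigcup_finite => [|q [_ //]]; apply: finite_setIl.
have SR s : S s -> R (s ^ c^-1).
  move=> Ss; set t := s ^ c^-1.
  have t1 : t <> 1.
    by move=> /eqP; rewrite conjg_eq1 => /eqP; apply/eqP/(refl_neq1 HS)/refl_gen.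
  have [q Rq tq] := has_ldesc HR (@subset_refl _ R) (gen_span HR t) t1.
  have qt : sepR (q * t) q = false by rewrite (sep_mul_refl HR) ?tq //; apply: refl_gen.
  have := domain_translates e_geo cP Rq qt.
  rewrite -mulgA outside_refl // => /negbFE.
  rewrite conjgVM.
  rewrite outsideM cP // addFb (sep_gen HS) // => /eqP qs.
  by rewrite /t -qs conjgK.
exists c => r; split=> [Rr|/SR]; last by rewrite conjgK.
pose X := [set r | R r /\ S (r ^ c)].
have XR : X `<=` R by move=> x [].
suff Xr : span X r by have [] := gen_in_span HR XR Rr Xr.
rewrite -[r](conjgK c); elim/span_ind: (r ^ c) / (gen_span HS (r ^ c)).
  by rewrite conj1g; apply: span1.
move=> w s _ IHw Ss; rewrite conjMg; apply: spanMr => //.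
by split; [apply: SR|rewrite conjgKV].
Qed.

End TwoSystems.

(** * The cocycle of a Coxeter presentation *)

Lemma addb_double (F : nat -> bool) n : (forall i, F (i + n) = F i) ->
  \big[addb/false]_(0 <= i < n.*2) F i = false.
Proof.
move=> Fn; rewrite -addnn (@big_cat_nat _ _ _ n) ?leq_addr //=.
rewrite -{2}[n]add0n big_addn addnK [X in _ (+) X](eq_bigr F) ?addbb //.
Qed.

Section Presentation.
Variables (W : groupType) (S : set W) (m : S -> S -> nat).
Hypothesis m_cox : coxeter_matrix m.
Hypothesis m_pres : presents (fun s : S => val s) (coxeter_relators m).
Local Notation letter := (fun s : S => val s).
Local Notation ev := (word_eval letter).
Implicit Types (u v : word S) (x t w : W).

Lemma ev_cat u v : ev (u ++ v) = ev u * ev v.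
Proof. by rewrite /word_eval big_cat. Qed.

Lemma ev_cons a u : ev (a :: u) = (if a.2 then (val a.1)^-1 else val a.1) * ev u.
Proof. by rewrite /word_eval big_cons. Qed.

Lemma ev_relator k (s s' : S) :
  ev (flatten (nseq k [:: (s, false); (s', false)])) = (val s * val s') ^+ k.
Proof.
elim: k => [|k IHk]; first by rewrite /word_eval big_nil.
by rewrite [flatten _]/= !ev_cons IHk /= expgS mulgA.
Qed.

Lemma relation (s s' : S) : (val s * val s') ^+ m s s' = 1.
Proof.
rewrite -ev_relator; have -> : 1 = ev [::] by rewrite /word_eval big_nil.
apply/m_pres.2; set r := flatten _; rewrite -[r]cats0 -[r ++ _]cat0s.
by apply: (@word_eq_relator _ _ [::] [::] r); exists s, s'.
Qed.

Lemma letter_invol (s : S) : val s * val s = 1.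
Proof. by have := relation s s; case: m_cox => -> _ _; rewrite expg1. Qed.

Lemma ev_letter (a : S * bool) u : ev (a :: u) = val a.1 * ev u.
Proof. by rewrite ev_cons invol_inv ?if_same //; apply: letter_invol. Qed.

(** The parity of the number of times that the gallery read from [u] starting
    at [x] crosses the wall of [t]. *)
Fixpoint crossings x u t : bool :=
  if u is a :: v then (t ^ x == val a.1) (+) crossings (x * val a.1) v t
  else false.

Lemma crossings_cat x u v t :
  crossings x (u ++ v) t = crossings x u t (+) crossings (x * ev u) v t.
Proof.
elim: u x => [|a u IHu] x; first by rewrite /word_eval big_nil mulg1.
by rewrite /= IHu ev_letter addbA mulgA.
Qed.

(** The walls crossed along [(s s')^k] are those of the palindromes. *)
Lemma crossings_relator x k (s s' : S) t :
  crossings x (flatten (nseq k [:: (s, false); (s', false)])) t =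
  \big[addb/false]_(0 <= i < k.*2) (t ^ x == (val s * val s') ^+ i * val s).
Proof.
have ss := letter_invol s; have ss' := letter_invol s'.
elim: k x => [|k IHk] x; first by rewrite big_geq.
rewrite doubleS !big_nat_recl //= {}IHk conjgM !expg0 expg1 mul1g.
congr (_ (+) (_ (+) _)).
  rewrite conjg_eqV; congr (_ == _).
  by rewrite conjgE invgK (invol_inv ss) mulgA.
apply: eq_bigr => i _; rewrite -(mulgA x) conjgM conjg_eqV; congr (_ == _).
rewrite conjgE invgK invgM !invol_inv // !expgS.
by rewrite -!mulgA; congr (_ * (_ * _)); rewrite !mulgA -(mulgA _ _ (val s')) -expgSr expgS.
Qed.

(** A relator [(s s')^m] crosses each of its walls twice, since the palindromes
    repeat with period [m]. *)
Lemma crossings_word_eq u v x t : word_eq (coxeter_relators m) u v ->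
  crossings x u t = crossings x v t.
Proof.
move=> uv; elim: uv x => {u v} [//|u v _ IH x|u v w _ IH1 _ IH2 x|u v s b x|u v r rel x].
- by rewrite IH.
- by rewrite IH1.
- rewrite !(crossings_cat x u); congr (_ (+) _); rewrite /= (conjgM _ (x * ev u)).
  rewrite -(mulgA _ (val s)) letter_invol mulg1 addbA.
  have -> : ((t ^ (x * ev u)) ^ val s == val s) = (t ^ (x * ev u) == val s).
    by rewrite conjg_eqV; congr (_ == _); rewrite conjgE invgK mulgV mulg1.
  by rewrite addbb.
- rewrite !crossings_cat; congr (_ (+) _).
  have [s [s' rE]] := rel; have := relation s s'; rewrite -ev_relator -rE => evr.
  rewrite evr mulg1 rE crossings_relator.
  by rewrite addb_double // => i; rewrite expgnDr relation mulg1.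
Qed.

Theorem cocycle_of_presentation : exists sep, reflection_cocycle S sep.
Proof.
have [f fE] := choice m_pres.1.
have S_invol s : S s -> s * s = 1.
  by move=> Ss; apply: (letter_invol (SigSub (mem_set Ss))).
exists (fun w => crossings 1 (f w)); split => //.
- move=> w; rewrite -(fE w); elim: (f w) => [|a u IHu].
    by rewrite /word_eval big_nil; apply: span1.
  rewrite ev_letter; apply: spanM => //; apply: span_gen; exact: set_valP.
- move=> t; rewrite (@crossings_word_eq _ [::]) //; apply/m_pres.2.
  by rewrite fE /word_eval big_nil.
- move=> x s t Ss; pose s0 : S := SigSub (mem_set Ss).
  rewrite (@crossings_word_eq _ (f x ++ [:: (s0, false)])).
    by rewrite crossings_cat /= fE mul1g addbF.
  by apply/m_pres.2; rewrite ev_cat !fE ev_letter /word_eval big_nil mulg1.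
Qed.

End Presentation.

(** * Automorphisms and parabolic subgroups *)

Lemma spanP (W : groupType) (J : set W) w :
  invols J -> generated J w <-> span J w.
Proof.
move=> iJ; split=> [gw|Jw].
  apply: (gw (span J)); split; last by move=> x; apply: span_gen.
  split=> [|x y]; first by rewrite inE; apply: span1.
  by rewrite !inE => Jx Jy; apply: spanM => //; apply: spanV.
move=> H [[H1 HV] JH]; elim/span_ind: w / Jw => [|w s _ Hw Js].
  by rewrite inE in H1.
have := HV w s; rewrite !inE (invol_inv (iJ _ Js)); apply => //; exact: JH.
Qed.

Lemma generatedE (W : groupType) (J : set W) : invols J -> generated J = span J.
Proof. by move=> iJ; apply/seteqP; split=> w /spanP; apply. Qed.

Lemma span_finite_support (W : groupType) (S : set W) w : span S w ->
  exists2 F, F `<=` S /\ finite_set F & span F w.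
Proof.
elim/span_ind=> [|{}w s _ [F [FS Ff] Fw] Ss].
  by exists set0; [split=> //; apply: finite_set0|apply: span1].
exists (F `|` [set s]).
  split; first by move=> x [/FS|->].
  by rewrite finite_setU; split=> //; apply: finite_set1.
apply: spanMr; last by right.
by apply: sub_span Fw => x; left.
Qed.

(** Finitely many generators of the group involve finitely many elements of [S],
    and no proper subset of [S] generates. *)
Lemma finite_cocycle (W : groupType) (S : set W) sep :
  reflection_cocycle S sep -> finitely_generated W -> finite_set S.
Proof.
move=> H [g gW].
have [F [FS Ff] gF] : exists2 F, F `<=` S /\ finite_set F &
    forall x, x \in g -> span F x.
  elim: g {gW} => [|x g [F [FS Ff] Fg]].
    by exists set0; [split=> //; apply: finite_set0|].
  have [E [ES Ef] Ex] := span_finite_support (gen_span H x).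
  exists (E `|` F).
    by split; [move=> y [/ES|/FS]|rewrite finite_setU].
  move=> y; rewrite in_cons => /orP[/eqP ->|/Fg Fy].
    by apply: sub_span Ex => z; left.
  by apply: sub_span Fy => z; right.
have iF := involS H FS.
apply: sub_finite_set Ff => s Ss; apply: (gen_in_span H FS Ss).
have : [set: W] s by []. 
rewrite -gW => /(_ (span F)); apply; split; last exact: gF.
split=> [|x y]; first by rewrite inE; apply: span1.
by rewrite !inE => Jx Jy; apply: spanM => //; apply: spanV.
Qed.

Section Automorphism.
Variables (W : groupType) (S : set W) (alpha : {multiplicative W -> W}).
Hypothesis alpha_bij : bijective alpha.
Let alpha_inj := bij_inj alpha_bij.

Lemma alpha1 : alpha 1 = 1.
Proof. by apply: (@mulgI _ (alpha 1)); rewrite -gmulfM !mulg1. Qed.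

Lemma alphaV x : alpha x^-1 = (alpha x)^-1.
Proof. by apply/esym/mulg1_eq; rewrite -gmulfM mulgV alpha1. Qed.

Lemma alphaJ x y : alpha (x ^ y) = alpha x ^ alpha y.
Proof. by rewrite !conjgE !gmulfM alphaV. Qed.

Lemma alphaX x n : alpha (x ^+ n) = alpha x ^+ n.
Proof. by elim: n => [|n IHn]; [exact: alpha1|rewrite !expgS gmulfM IHn]. Qed.

Lemma span_image I x :
  span (alpha @` I) x <-> exists2 y, span I y & x = alpha y.
Proof.
split.
  elim/span_ind=> [|{}x _ _ [y Iy ->] [s Is <-]].
    by exists 1; [exact: span1|rewrite alpha1].
  by exists (y * s); [exact: spanMr|rewrite gmulfM].
move=> [y Iy ->]; elim/span_ind: y / Iy => [|y s _ IH Is].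
  by rewrite alpha1; apply: span1.
by rewrite gmulfM; apply: spanMr => //; exists s.
Qed.

Lemma cocycle_image sep : reflection_cocycle S sep ->
  exists sepR, reflection_cocycle (alpha @` S) sepR.
Proof.
move=> H; have [beta alphaK betaK] := alpha_bij.
exists (fun w t => sep (beta w) (beta t)).
have betaM : {morph beta : x y / x * y}.
  by move=> x y; apply: alpha_inj; rewrite gmulfM !betaK.
have beta1 : beta 1 = 1 by apply: alpha_inj; rewrite betaK alpha1.
split.
- by move=> _ [s Ss <-]; rewrite -gmulfM (gen_invol H Ss) alpha1.
- by move=> w; apply/span_image; exists (beta w); rewrite ?betaK //; apply: (gen_span H).
- by move=> t; rewrite beta1 (sep1 H).
- move=> x _ t [s Ss <-]; rewrite betaM alphaK (sepMs H) //; congr (_ (+) _).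
  rewrite -(inj_eq alpha_inj) alphaJ !betaK //.
Qed.

End Automorphism.

Lemma conj_image (W : groupType) (w x : W) : w * x * w^-1 = x ^ w^-1.
Proof. by rewrite conjgE invgK mulgA. Qed.

Lemma parabolic_conjP (W : groupType) (J : set W) (w x : W) : invols J ->
  [set w * x * w^-1 | x in generated J] x <-> span J (x ^ w).
Proof.
move=> iJ; rewrite generatedE //; split=> [[y Jy <-]|Jx].
  by rewrite conj_image conjgKV.
by exists (x ^ w); rewrite // conj_image conjgK.
Qed.

Section Main.
Variables (W : groupType) (S : set W) (alpha : {multiplicative W -> W}).
Variable sep : W -> W -> bool.
Hypotheses (H : reflection_cocycle S sep) (alpha_bij : bijective alpha).
Let alpha_inj := bij_inj alpha_bij.

Lemma graph_preserves_parabolics : inner_by_graph S alpha ->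
  forall P, parabolic S P -> parabolic S (alpha @` P).
Proof.
move=> [c cE] _ [J [w [JS ->]]].
have alphaS s : S s -> S (alpha s ^ c).
  move=> Ss; have : (alpha @` S) (alpha s) by exists s.
  by rewrite cE => -[t St <-]; rewrite conj_image conjgKV.
pose K := [set alpha s ^ c | s in J].
have KS : K `<=` S by move=> _ [s Js <-]; apply/alphaS/JS.
have iJ := involS H JS; have iK := involS H KS.
have KE y : span K (alpha y ^ c) <-> span J y.
  split=> [|Jy].
    move zE : (alpha y ^ c) => z Kz; elim/span_ind: z / Kz y zE => [y /eqP|].
      by rewrite conjg_eq1 -(alpha1 alpha) => /eqP /alpha_inj ->; apply: span1.
    move=> z _ _ IHz [s Js <-] y yE; have ss := iJ _ Js.
    rewrite -[y]mulg1 -ss mulgA; apply: spanMr => //; apply: IHz.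
    by rewrite gmulfM conjMg yE -mulgA -conjMg -gmulfM ss alpha1 conj1g mulg1.
  elim/span_ind: y / Jy => [|y s _ IH Js].
    by rewrite alpha1 conj1g; apply: span1.
  by rewrite gmulfM conjMg; apply: spanMr => //; exists s.
exists K, (alpha w * c); split => //; apply/seteqP; split=> x.
  move=> [y /(parabolic_conjP w y iJ) Jy <-]; apply/parabolic_conjP => //.
  by rewrite conjgM -alphaJ; apply/KE.
move=> /parabolic_conjP => /(_ iK); have [beta _ betaK] := alpha_bij.
rewrite conjgM -[x]betaK -alphaJ => /KE Jx.
by exists (beta x) => //; apply/parabolic_conjP.
Qed.

Lemma graph_preserves_products : inner_by_graph S alpha ->
  forall s t, S s -> S t ->
  exists s' t', [/\ S s', S t' & conjugate (alpha (s * t)) (s' * t')].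
Proof.
move=> [c cE] s t Ss St.
have alphaS u : S u -> exists2 v, S v & c * v * c^-1 = alpha u.
  move=> Su; have : (alpha @` S) (alpha u) by [exists u].
  by rewrite cE => -[v Sv e]; exists v.
have [s' Ss' se] := alphaS s Ss; have [t' St' te] := alphaS t St.
exists s', t'; split=> //; exists c^-1; rewrite gmulfM -se -te invgK.
by rewrite !mulgA mulVg mul1g !mulgVK.
Qed.

Hypothesis parabolic_alpha : forall P, parabolic S P -> parabolic S (alpha @` P).
Hypothesis product_alpha : forall s t, S s -> S t -> finite_order (s * t) ->
  exists s' t', [/\ S s', S t' & conjugate (alpha (s * t)) (s' * t')].

Lemma span_parabolic_image I : I `<=` S -> exists J d, J `<=` S /\
  forall x, span (alpha @` I) x <-> span J (x ^ d).
Proof.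
move=> IS; have iI := involS H IS.
have [|J [d [JS JE]]] := parabolic_alpha (P := span I).
  exists I, 1; split=> //; apply/seteqP; split=> x; rewrite parabolic_conjP ?conjg1 //.
exists J, d; split=> // x; rewrite span_image -parabolic_conjP -?JE; last exact: (involS H).
by split=> [[y Iy ->]|[y Iy <-]]; exists y.
Qed.

(** The image of [{1, s}] is a parabolic subgroup of order two. *)
Lemma image_reflection r : (alpha @` S) r -> refl S r.
Proof.
move=> [s Ss <-]; have IS : [set s] `<=` S by move=> _ ->.
have [J [d [JS JE]]] := span_parabolic_image IS.
have Js : span J (alpha s ^ d) by apply/JE/span_gen; exists s.
have s1 : alpha s ^ d <> 1.
  move/eqP; rewrite conjg_eq1 -(alpha1 alpha) => /eqP /alpha_inj.
  exact/eqP/(refl_neq1 H)/refl_gen.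
have [a Ja _] := has_ldesc H JS Js s1.
have /JE/span_image[y Iy aE] : span J ((a ^ d^-1) ^ d).
  by rewrite conjgKV; apply: span_gen.
have a1 : a ^ d^-1 <> 1.
  by move/eqP; rewrite conjg_eq1 => /eqP; apply/eqP/(refl_neq1 H)/refl_gen/JS.
have ys : y = 1 \/ y = s.
  elim/span_ind: y / Iy {aE} => [|y _ _ [->|->] ->]; first by left.
    by right; rewrite mul1g.
  by left; apply: (gen_invol H Ss).
case: ys => yE; rewrite yE in aE; first by case: a1; rewrite aE alpha1.
by exists a, d^-1; split=> //; apply: JS.
Qed.

Lemma preserving_inner_by_graph : finitely_generated W -> inner_by_graph S alpha.
Proof.
move=> W_fg; have [sepR HR] := cocycle_image alpha_bij H.
have R_fin : finite_set (alpha @` S).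
  by apply: finite_image; apply: (finite_cocycle H).
have [||c cE] := conjugate_systems H HR R_fin image_reflection.
- move=> _ _ [s Ss <-] [t St <-] _.
  have [J [d [JS JE]]] := span_parabolic_image (pair_sub Ss St).
  exists J, d; split=> // x; rewrite -JE.
  suff -> : [set alpha s; alpha t] = alpha @` [set s; t] by [].
  by rewrite image_setU !image_set1.
- move=> _ _ [s Ss <-] [t St <-] [k k0 e].
  have [|s' [t' [Ss' St' [w wE]]]] := product_alpha Ss St.
    exists k => //; apply: alpha_inj.
    by rewrite alphaX alpha1 gmulfM.
  exists w^-1, s', t'; split=> //.
  by rewrite -gmulfM wE conj_image.
exists c; apply/seteqP; split=> [r /cE Sr|_ [s Ss <-]].
  by exists (r ^ c); rewrite // conj_image conjgK.
by apply/cE; rewrite conj_image conjgKV.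
Qed.

End Main.

Unset Implicit Arguments.

Theorem theorem1p3 (W : groupType) (S : set W) (alpha : {multiplicative W -> W})
    (W_fg : finitely_generated W)
    (S_cox : coxeter_generating_set S)
    (alpha_bij : bijective alpha) :
  inner_by_graph S alpha <->
  (forall P : set W, parabolic S P -> parabolic S (alpha @` P)) /\
  (forall s t : W, S s -> S t -> finite_order (s * t) ->
     exists s' t' : W, [/\ S s', S t' & conjugate (alpha (s * t)) (s' * t')]).
Proof.
have [m [m_cox m_pres]] := S_cox.
have [sep H] := cocycle_of_presentation m_cox m_pres.
split=> [inner|[par prod]]; last exact: (preserving_inner_by_graph H alpha_bij).
split=> [|s t Ss St _]; first exact: (graph_preserves_parabolics H alpha_bij).
exact: graph_preserves_products.
Qed.
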